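(* Let $\Omega\subset\mathbb{R}^n$ be a bounded domain with regular boundary, $\lambda,\kappa,\gamma>0$, $\alpha,\beta\in\mathbb{R}$, $p>-1$, and put $C_p=\frac{|p|}{2\sqrt{p+1}}$. Let $\tilde\gamma\in\mathbb{R}$ with $\tilde\gamma<\lambda\lambda_1$, and let $v$ be a (sufficiently regular, complex-valued, exponentially decaying) solution of $$v_t-(\lambda+i\alpha)\Delta v+(\kappa+i\beta)|v|^p v-\tilde\gamma v=0,\quad x\in\Omega,\ t>0,\qquad v=0\ \text{ on }\partial\Omega,\ t>0,$$ with initial value $v_0=v(\cdot,0)$. Suppose that $\mu\ge\gamma$, that $N$ is a positive integer with $\lambda_{N+1}>\frac{\gamma}{\lambda}$, and that $\kappa\ge C_p|\beta|$. Let $u$ be a (sufficiently regular, complex-valued) solution of the controlled system $$u_t-(\lambda+i\alpha)\Delta u+(\kappa+i\beta)|u|^p u-\gamma u=-\mu\sum_{k=1}^{N}(u-v,w_k)\,w_k,\quad x\in\Omega,\ t>0,\qquad u=0\ \text{ on }\partial\Omega,\ t>0,$$ with initial value $u_0=u(\cdot,0)$. Put $$\omega=2(\lambda-\gamma\lambda_{N+1}^{-1})\lambda_1,\qquad \tilde\omega=2(\tilde\gamma-\gamma\lambda_{N+1}^{-1}\lambda_1).$$ Then $u$ converges to $v$ as $t$ increases. More precisely: (1) If $\tilde\gamma\in\left(\gamma\lambda_{N+1}^{-1}\lambda_1,\ \lambda\lambda_1\right)$, then for every $0<\epsilon<\tilde\omega$ and all $t\ge0$, $$\|u(t)-v(t)\|_{L^2(\Omega)}^2\le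 e^{-(\omega-\epsilon)t}\|u_0-v_0\|_{L^2(\Omega)}^2+\frac{|\tilde\gamma-\gamma|^2}{\epsilon}\|v_0\|_{L^2(\Omega)}^2\,\frac{1}{\tilde\omega-\epsilon}\,e^{2(\tilde\gamma-\lambda\lambda_1)t}.$$ (2) If $\tilde\gamma\in\left(-\infty,\ \gamma\lambda_{N+1}^{-1}\lambda_1\right]$, then for every $0<\epsilon<\omega$ and all $t\ge0$, $$\|u(t)-v(t)\|_{L^2(\Omega)}^2\le e^{-(\omega-\epsilon)t}\|u_0-v_0\|_{L^2(\Omega)}^2+\frac{|\tilde\gamma-\gamma|^2}{\epsilon}\|v_0\|_{L^2(\Omega)}^2\,\frac{1}{\epsilon-\tilde\omega}\,e^{-(\omega-\epsilon)t}.$$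
   Context: $(\cdot,\cdot)$ is the inner product $(f,g)=\int_\Omega f\bar g\,dx$ of $L^2(\Omega)$. $(w_k)_{k\ge1}$ is an orthonormal basis of $L^2(\Omega)$ consisting of eigenfunctions of $-\Delta$ with homogeneous Dirichlet boundary condition, with corresponding eigenvalues $0<\lambda_1\le\lambda_2\le\cdots$, $\lambda_k\to\infty$, counted with multiplicity. (The parameter $\lambda$ without index is a coefficient of the equation.) The expression $|z|^pz$ is understood as $0$ at $z=0$. ''Exponentially decaying'' is not an extra hypothesis: under $\tilde\gamma<\lambda\lambda_1$ every such $v$ satisfies $\|v(t)\|_{L^2(\Omega)}\le\|v_0\|_{L^2(\Omega)}e^{-(\lambda\lambda_1-\tilde\gamma)t}$. ''Regular boundary'' means smooth enough for standard elliptic theory (e.g. $C^2$). The existence of the solutions is assumed. ''Sufficiently regular'' means regular enough in time and space that one may multiply the equation for $v$ by $\bar v$ and the difference of the equations by $\bar u-\bar v$, integrate over $\Omega$, integrate by parts and differentiate the squared $L^2$ norms of $v$ and $u-v$ in time; for definiteness one may take $u,v\in C([0,\infty);H^2(\Omega)\cap H^1_0(\Omega))\cap C^1([0,\infty);L^2(\Omega))$. *)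

(* Defs.v *)
From HB Require Import structures.
From mathcomp Require Import all_boot all_order all_algebra.
From mathcomp Require Import all_classical all_reals all_analysis.
From mathcomp Require Import measurable_realfun.
From mathcomp.real_closed Require Import complex.

Set Implicit Arguments.
Unset Strict Implicit.
Unset Printing Implicit Defensive.

Import Order.TTheory GRing.Theory Num.Theory.
Import numFieldNormedType.Exports.

Local Open Scope classical_set_scope.
Local Open Scope ring_scope.

Section borel_rV.
Context (R : realType) (n : nat).

HB.instance Definition _ := @isMeasurable.Build
  (sigma_display (@open 'rV[R]_n)) 'rV[R]_n <<s @open 'rV[R]_n >>
  (@sigma_algebra0 _ setT _) (@sigma_algebraC _ _)
  (@sigma_algebra_bigcup _ setT _).

Local Notation ratr_rV q := (map_mx ratr q : 'rV[R]_n).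

Lemma open_measurable_rV (U : set 'rV[R]_n) : open U -> measurable U.
Proof. exact: sub_sigma_algebra. Qed.

Lemma open_rV_bigcup_ball (U : set 'rV[R]_n) : open U ->
  U = \bigcup_(qk : 'rV[rat]_n * nat)
        [set y : 'rV[R]_n |
          (forall z, ball (ratr_rV qk.1) qk.2.+1%:R^-1 z -> U z)
          /\ ball (ratr_rV qk.1) qk.2.+1%:R^-1 y].
Proof.
move=> oU; apply/seteqP; split=> [x Ux|x [qk _ [/= qkU qkx]]]; last exact: qkU.
have /nbhs_ballP[e /= e0 eU] := open_nbhs_nbhs (conj oU Ux).
have [k ke] : exists k, k.+1%:R^-1 < e / 2 :> R.
  exists (Num.truncn (e / 2)^-1).
  rewrite invf_plt ?posrE ?divr_gt0// ?ltr0n//.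
  by rewrite truncnS_gt.
have k0 : 0 < k.+1%:R^-1 :> R by rewrite invr_gt0 ltr0n.
have H i : exists q : rat, ball (x ord0 i) k.+1%:R^-1 (ratr q).
  have [y [xy [q _ qy]]] := @dense_rat R (ball (x ord0 i) k.+1%:R^-1)
    (ex_intro _ _ (ballxx (x ord0 i) k0)) (ball_open _ _).
  by exists q; rewrite qy.
pose q : 'rV[rat]_n := \row_i xget 0 [set q | ball (x ord0 i) k.+1%:R^-1 (ratr q)].
have qx : ball (ratr_rV q) k.+1%:R^-1 x.
  apply: ball_sym; split=> // i j; rewrite (ord1 i) !mxE.
  by have /(xgetPex 0) := H j.
exists (q, k) => //=; split=> // z qz.
apply: eU; apply: (@le_ball _ _ _ (k.+1%:R^-1 + k.+1%:R^-1)).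
  by rewrite (splitr e) lerD// ltW.
by apply: ball_triangle qz; exact: ball_sym.
Qed.

End borel_rV.

Section lebesgue_rV.
Context (R : realType).

Definition rV_cons n (p : measurableTypeR R * 'rV[R]_n) : 'rV[R]_n.+1 :=
  \row_i (if unlift ord0 i is Some j then p.2 ord0 j else p.1).

Lemma ball_rV_cons n (a : 'rV[R]_n.+1) e (p : measurableTypeR R * 'rV[R]_n) :
  ball a e (rV_cons p) <->
  ball (a ord0 ord0 : R) e p.1 /\
  ball (\row_j a ord0 (lift ord0 j) : 'rV[R]_n) e p.2.
Proof.
split=> [[e0 ap]|[ap1 [e0 ap2]]].
  split; first by have := ap ord0 ord0; rewrite mxE unlift_none.
  split=> // i j; have := ap ord0 (lift ord0 j).
  by rewrite !mxE liftK (ord1 i).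
split=> // i j; rewrite (ord1 i) mxE; case: unliftP => [k|] ->//.
by have := ap2 ord0 k; rewrite mxE.
Qed.

Lemma measurable_rV_cons n :
  measurable_fun [set: measurableTypeR R * 'rV[R]_n] (@rV_cons n).
Proof.
apply: (@measurability _ _ _ _ _ _ (@open 'rV[R]_n.+1)) => //.
move=> _ [U oU <-]; rewrite setTI (open_rV_bigcup_ball oU) preimage_bigcup.
apply: countable_bigcupT_measurable => // -[q k] /=.
set B := ball _ _.
have [BU|BU] := pselect (forall z, B z -> U z); last first.
  by rewrite (_ : _ @^-1` _ = set0)//; apply/seteqP; split=> // y [].
rewrite (_ : _ @^-1` _ =
  (ball (ratr (q ord0 ord0) : R) k.+1%:R^-1) `*`
  (ball (\row_j ratr (q ord0 (lift ord0 j)) : 'rV[R]_n) k.+1%:R^-1)).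
  apply: measurableX; last by apply: open_measurable_rV; exact: ball_open.
  exact: measurable_ball.
have rE : (\row_j ratr (q ord0 (lift ord0 j)) : 'rV[R]_n)
    = \row_j (map_mx ratr q : 'rV[R]_n.+1) ord0 (lift ord0 j).
  by apply/rowP => j; rewrite !mxE.
apply/seteqP; split=> -[y1 y2] /=.
  by move=> [_ /ball_rV_cons]; rewrite mxE rE.
by move=> H; split=> //; apply/ball_rV_cons; rewrite mxE -rE.
Qed.

Definition rV_uncons n (y : 'rV[R]_n.+1) : measurableTypeR R * 'rV[R]_n :=
  (y ord0 ord0, \row_j y ord0 (lift ord0 j)).

Lemma rV_consK n : cancel (@rV_cons n) (@rV_uncons n).
Proof.
move=> [a y]; rewrite /rV_uncons mxE unlift_none; congr pair.
by apply/rowP => j; rewrite !mxE liftK.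
Qed.

Lemma rV_unconsK n : cancel (@rV_uncons n) (@rV_cons n).
Proof.
by move=> y; apply/rowP => j; rewrite mxE; case: unliftP => [k|] -> //=; rewrite mxE.
Qed.

Lemma continuous_rV_behead n :
  continuous (fun y : 'rV[R]_n.+1 => \row_j y ord0 (lift ord0 j) : 'rV[R]_n).
Proof.
move=> y U /nbhs_ballP[e /= e0 eU]; apply/nbhs_ballP; exists e => //= z [_ yz].
by apply: eU; split=> // i j; rewrite !mxE; exact: yz.
Qed.

Lemma measurable_rV_uncons n : measurable_fun setT (@rV_uncons n).
Proof.
apply/measurable_fun_pairP; split => /=.
  apply: (measurability _ (RGenOpens.measurableE R)) => _ [_ [a [b ->]] <-].
  rewrite setTI; apply: open_measurable_rV.
  apply: open_comp; last exact: interval_open.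
  by move=> y _; exact: coord_continuous.
apply: (@measurability _ _ _ _ _ _ (@open 'rV[R]_n)) => // _ [U oU <-].
rewrite setTI; apply: open_measurable_rV; apply: open_comp => // y _.
exact: continuous_rV_behead.
Qed.

Section cons_measure.
Context n (mu : {sigma_finite_measure set 'rV[R]_n -> \bar R}).

Let prod_measure :
    {measure set (measurableTypeR R * 'rV[R]_n)%type -> \bar R} :=
  (@lebesgue_measure R \x mu)%E.

Definition cons_measure : set 'rV[R]_n.+1 -> \bar R :=
  pushforward (@lebesgue_measure R \x mu)%E (@rV_cons n).

HB.instance Definition _ := Measure.copy cons_measure
  (measure_function_pushforward__canonical__measure_function_Measure
    prod_measure (@measurable_rV_cons n)).

Let cons_measure_sigma_finite : sigma_finite setT cons_measure.
Proof.
have /sigma_finiteP[F [TF ndF Foo]] := sigma_finiteT (@lebesgue_measure R).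
have /sigma_finiteP[G [TG ndG Goo]] := sigma_finiteT mu.
exists (fun k => @rV_uncons n @^-1` (F k `*` G k)).
  rewrite -preimage_bigcup (_ : \bigcup_k _ = setT) ?preimage_setT//.
  rewrite -setXTT TF TG; apply/seteqP; split=> -[x y].
    by move=> [k _ [/= Fx Gy]]; split; exists k.
  move=> [/= [i _ Fx] [j _ Gy]]; exists (maxn i j) => //; split=> /=.
    by move: x Fx; exact/subsetPset/ndF/leq_maxl.
  by move: y Gy; exact/subsetPset/ndG/leq_maxr.
move=> k; have [mF Fk] := Foo k; have [mG Gk] := Goo k; split.
  rewrite -[X in measurable X]setTI.
  by apply: measurable_rV_uncons => //; exact: measurableX.
rewrite /cons_measure /pushforward -comp_preimage.
rewrite (_ : _ \o _ = id) ?preimage_id; last first.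
  by apply/funext => p /=; rewrite rV_consK.
by rewrite product_measure1E// lte_mul_pinfty// ge0_fin_numE.
Qed.

HB.instance Definition _ := Measure_isSigmaFinite.Build _ _ _ cons_measure
  cons_measure_sigma_finite.

End cons_measure.

Fixpoint lebesgue_rV n : {sigma_finite_measure set 'rV[R]_n -> \bar R} :=
  match n return {sigma_finite_measure set 'rV[R]_n -> \bar R} with
  | 0 => dirac (0 : 'rV[R]_0)
  | m.+1 => cons_measure (lebesgue_rV m)
  end.

End lebesgue_rV.

Section classical_calculus.
Context (R : realType) (n : nat).
Implicit Types (f : 'rV[R]_n -> R) (phi : 'rV[R]_n -> R[i]).

Definition basis_rV (i : 'I_n) : 'rV[R]_n := delta_mx 0 i.

Fixpoint of_class_C (k : nat) f : Prop :=
  continuous f /\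
  if k is k'.+1 then
    forall i, (forall x, derivable f x (basis_rV i)) /\
      of_class_C k' (fun x => 'D_(basis_rV i) f x)
  else True.

Definition partialC (i : 'I_n) phi : 'rV[R]_n -> R[i] := fun x =>
  Complex ('D_(basis_rV i) (fun y => complex.Re (phi y)) x)
          ('D_(basis_rV i) (fun y => complex.Im (phi y)) x).

Definition supportC phi : set 'rV[R]_n := closure [set x | phi x != 0].

Definition test_function (Omega : set 'rV[R]_n) phi : Prop :=
  [/\ forall k, of_class_C k (fun x => complex.Re (phi x)),
      forall k, of_class_C k (fun x => complex.Im (phi x)),
      compact (supportC phi) & supportC phi `<=` Omega].

(* Local defining functions: near each boundary point, Omega is the strict
   sublevel set of a C^2 function whose gradient does not vanish there. *)
Definition C2_boundary (Omega : set 'rV[R]_n) : Prop :=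
  forall x, (closure Omega `\` interior Omega) x ->
    exists (r : R) (psi : 'rV[R]_n -> R),
      [/\ 0 < r, of_class_C 2 psi,
          exists i, 'D_(basis_rV i) psi x != 0 &
          forall y, ball x r y -> (Omega y <-> psi y < 0)].

Definition bounded_C2_domain (Omega : set 'rV[R]_n) : Prop :=
  [/\ Omega !=set0, open Omega, connected Omega, bounded_set Omega &
      C2_boundary Omega].

End classical_calculus.

(* An element of L^2(Omega) is given by a representative that is Borel on Omega
   (every class has one); its values outside Omega are irrelevant. *)
Section sobolev.
Context (R : realType) (n : nat) (Omega : set 'rV[R]_n).
Implicit Types (f g phi : 'rV[R]_n -> R[i]) (u ut : R -> 'rV[R]_n -> R[i]) (s t : R).

Definition integralC f : R[i] :=
  Complex (\int[@lebesgue_rV R n]_(x in Omega) complex.Re (f x))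
          (\int[@lebesgue_rV R n]_(x in Omega) complex.Im (f x)).

Definition innerL2 f g : R[i] := integralC (fun x => f x * (g x)^*%C).

Definition memL2 f : Prop :=
  [/\ measurable_fun Omega (fun x => complex.Re (f x)),
      measurable_fun Omega (fun x => complex.Im (f x)) &
      (\int[@lebesgue_rV R n]_(x in Omega) (Normc.normc (f x) ^+ 2)%:E < +oo)%E].

Definition normL2 f : R :=
  Num.sqrt (\int[@lebesgue_rV R n]_(x in Omega) (Normc.normc (f x) ^+ 2)).

Definition is_weak_partial (i : 'I_n) f g : Prop :=
  memL2 g /\ forall phi, test_function Omega phi ->
    innerL2 g phi = - innerL2 f (partialC i phi).

(* The weak partial derivative in L^2, meaningful only when it exists. *)
Definition weak_partial (i : 'I_n) f : 'rV[R]_n -> R[i] :=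
  xget (fun=> 0) [set g | is_weak_partial i f g].

Definition memH1 f : Prop :=
  memL2 f /\ forall i, exists g, is_weak_partial i f g.

Definition memH2 f : Prop := memH1 f /\ forall i, memH1 (weak_partial i f).

Definition normH2 f : R :=
  Num.sqrt (normL2 f ^+ 2 + \sum_i normL2 (weak_partial i f) ^+ 2
    + \sum_i \sum_j normL2 (weak_partial j (weak_partial i f)) ^+ 2).

(* H^1_0 is the closure of the test functions in H^1: the left-hand side of the
   inequality is the squared H^1 norm of f - phi. *)
Definition memH10 f : Prop :=
  memH1 f /\ forall e : R, 0 < e -> exists phi, test_function Omega phi /\
    normL2 (fun x => f x - phi x) ^+ 2
    + \sum_i normL2 (fun x => weak_partial i f x - partialC i phi x) ^+ 2 < e.

Definition laplacian f : 'rV[R]_n -> R[i] :=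
  fun x => \sum_i weak_partial i (weak_partial i f) x.

Definition orthonormal_basisL2 (w : nat -> 'rV[R]_n -> R[i]) : Prop :=
  [/\ forall k, memL2 (w k),
      forall j k, innerL2 (w j) (w k) = (j == k)%:R &
      forall f, memL2 f ->
        normL2 (fun x => f x - \sum_(k < m) innerL2 f (w k) * w k x)
          @[m --> \oo] --> (0 : R)].

(* w k and lam k are the (k+1)-st eigenfunction and eigenvalue, k >= 0. *)
Definition dirichlet_eigenbasis (w : nat -> 'rV[R]_n -> R[i]) (lam : nat -> R)
    : Prop :=
  [/\ orthonormal_basisL2 w,
      forall k, [/\ memH2 (w k), memH10 (w k) &
        {ae @lebesgue_rV R n, forall x, Omega x ->
          - laplacian (w k) x = (lam k)%:C%C * w k x}],
      0 < lam 0%N, {homo lam : j k / (j <= k)%N >-> j <= k} &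
      lam k @[k --> \oo] --> +oo].

(* u belongs to C([0,oo); H^2 cap H^1_0) and to C^1([0,oo); L^2), with time
   derivative ut; the difference quotient is one-sided at t = 0. *)
Definition regular_evolution u ut : Prop :=
  [/\ forall t, 0 <= t -> memH2 (u t) /\ memH10 (u t),
      forall t, 0 <= t ->
        normH2 (fun x => u s x - u t x)
          @[s --> within [set s | 0 <= s] (nbhs t)] --> (0 : R),
      forall t, 0 <= t -> memL2 (ut t),
      forall t, 0 <= t ->
        normL2 (fun x => ((s - t)^-1)%:C%C * (u s x - u t x) - ut t x)
          @[s --> within [set s | 0 <= s] t^'] --> (0 : R) &
      forall t, 0 <= t ->
        normL2 (fun x => ut s x - ut t x)
          @[s --> within [set s | 0 <= s] (nbhs t)] --> (0 : R)].

End sobolev.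

(* |z|^p z; it vanishes at z = 0 whatever the value of 0 `^ p is. *)
Definition power_nonlinearity (R : realType) (p : R) (z : R[i]) : R[i] :=
  (Normc.normc z `^ p)%:C%C * z.

(* u_t - (l + i a) Lap u + (k + i b) |u|^p u - c u = F for t > 0, a.e. in Omega;
   the condition u = 0 on the boundary is membership in H^1_0. *)
Definition cgl_solution (R : realType) (n : nat) (Omega : set 'rV[R]_n)
    (l a k b p c : R) (u ut F : R -> 'rV[R]_n -> R[i]) : Prop :=
  regular_evolution Omega u ut /\
  forall t, 0 < t -> {ae @lebesgue_rV R n, forall x, Omega x ->
    ut t x - Complex l a * laplacian Omega (u t) x
      + Complex k b * power_nonlinearity p (u t x) - c%:C%C * u t x = F t x}.

Definition feedback (R : realType) (n : nat) (Omega : set 'rV[R]_n)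
    (w : nat -> 'rV[R]_n -> R[i]) (mu : R) (N : nat)
    (u v : R -> 'rV[R]_n -> R[i]) : R -> 'rV[R]_n -> R[i] := fun t x =>
  - mu%:C%C * \sum_(k < N) innerL2 Omega (fun y => u t y - v t y) (w k) * w k x.

(* Main.v *)
Require Import Defs.
From mathcomp Require Import all_boot all_order all_algebra.
From mathcomp Require Import all_classical all_reals all_analysis.
From mathcomp Require Import measurable_realfun.
From mathcomp.real_closed Require Import complex.
From mathcomp Require Import ring lra.

Set Implicit Arguments.
Unset Strict Implicit.
Unset Printing Implicit Defensive.

Import Order.TTheory GRing.Theory Num.Theory.
Import numFieldNormedType.Exports.

Local Open Scope classical_set_scope.
Local Open Scope ring_scope.

(** The theorem is an energy estimate for z = u - v.  Subtracting the equations,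
      z_t = (lambda + i alpha) Lap z + gamma z - mu P_N z + (gamma - gammat) v
            - (kappa + i beta) (|u|^p u - |v|^p v),
    and one takes the real part of the inner product with z.

    The nonlinear term has a sign, pointwise: if X is the product of
    |a|^p a - |b|^p b with the conjugate of a - b, then
    2 sqrt(p + 1) |Im X| <= |p| Re X, so that the hypothesis on kappa makes
    Re ((kappa + i beta) X) nonnegative ([power_nonlinearity_accretive]).  Hence
    the nonlinearity is dropped before integrating.

    The linear terms are diagonal in the eigenbasis: the coefficient of z on the
    k-th eigenfunction is damped by lambda lam_k - gamma + mu for k < N and by
    lambda lam_k - gamma for k >= N.  Both are at least
    (lambda - gamma / lam_N) lam_0, which is omega / 2
    ([dotL2_dissipation]).  That the Laplacian acts diagonally on
    H^2 and H^1_0 functions is Green's formula used twice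
    ([dotL2_laplacian_eigen]); alpha disappears since the eigenvalues are real.

    The remaining source term (gamma - gammat) v is split by Young's inequality
    with parameter eps, and v itself decays like exp ((gammat - lambda lam_0) t)
    by the same argument ([free_decay]).  This leaves
      E' <= - (omega - eps) E + K exp (2 (gammat - lambda lam_0) t)
    for E the squared norm of z, which [gronwall_forced] integrates to a single
    bound, valid for every positive eps other than omegat
    ([controlled_decay]).  Its forcing term is
      K / (omegat - eps) (exp (2 (gammat - lambda lam_0) t) - exp (- (omega - eps) t));
    each of the two stated estimates keeps the exponential whose coefficient is
    positive. *)

(** * Square-integrable complex functions *)

Lemma Re_mulcJ (R : realType) (a b : R[i]) :
  complex.Re (a * b^*%C) =
  complex.Re a * complex.Re b + complex.Im a * complex.Im b.
Proof. by case: a => a1 a2; case: b => b1 b2 /=; rewrite mulrN opprK. Qed.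

Lemma sqr_normcE (R : realType) (a : R[i]) :
  Normc.normc a ^+ 2 = complex.Re a ^+ 2 + complex.Im a ^+ 2.
Proof. by case: a => a1 a2 /=; rewrite sqr_sqrtr// addr_ge0// sqr_ge0. Qed.

Section L2.
Context (R : realType) (n : nat) (Omega : set 'rV[R]_n).
Context (mOmega : measurable Omega).
Implicit Types (f g h : 'rV[R]_n -> R[i]) (c : R[i]).
Local Notation mu := (@lebesgue_rV R n).

(** The real part of the inner product is a real scalar product with the same
    norm, and estimates live there; the imaginary part is recovered by rotating
    the second argument ([Im_innerL2]). *)
Definition dotL2 f g : R := complex.Re (innerL2 Omega f g).

Lemma dotL2E f g : dotL2 f g = \int[mu]_(x in Omega) complex.Re (f x * (g x)^*%C).
Proof. by []. Qed.

Lemma measurable_sqr_normc f :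
  measurable_fun Omega (fun x => complex.Re (f x)) ->
  measurable_fun Omega (fun x => complex.Im (f x)) ->
  measurable_fun Omega (fun x => Normc.normc (f x) ^+ 2).
Proof.
move=> m1 m2; rewrite (_ : (fun _ => _) =
  (fun x => complex.Re (f x) ^+ 2 + complex.Im (f x) ^+ 2)); last first.
  by apply/funext => x; rewrite sqr_normcE.
by apply: measurable_funD; exact: measurable_funX.
Qed.

Lemma memL2P f : memL2 Omega f <->
  [/\ measurable_fun Omega (fun x => complex.Re (f x)),
      measurable_fun Omega (fun x => complex.Im (f x)) &
      mu.-integrable Omega (fun x => (Normc.normc (f x) ^+ 2)%:E)].
Proof.
split=> -[m1 m2 foo]; split=> //.
  apply/integrableP; split; first by apply/measurable_EFinP; exact: measurable_sqr_normc.
  rewrite (eq_integral (fun x => (Normc.normc (f x) ^+ 2)%:E))// => x _.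
  by rewrite gee0_abs// lee_fin sqr_ge0.
have /integrableP[_] := foo.
rewrite (eq_integral (fun x => (Normc.normc (f x) ^+ 2)%:E))// => x _.
by rewrite gee0_abs// lee_fin sqr_ge0.
Qed.

Lemma integrable_Re_mulcJ f g : memL2 Omega f -> memL2 Omega g ->
  mu.-integrable Omega (EFin \o (fun x => complex.Re (f x * (g x)^*%C))).
Proof.
move=> /memL2P[f1 f2 fi] /memL2P[g1 g2 gi].
apply: (@le_integrable _ _ _ _ _ mOmega _
  (fun x => (Normc.normc (f x) ^+ 2)%:E + (Normc.normc (g x) ^+ 2)%:E)%E).
- apply/measurable_EFinP; under eq_fun do rewrite Re_mulcJ.
  by apply: measurable_funD; exact: measurable_funM.
- move=> x _; rewrite /= lee_fin !sqr_normcE Re_mulcJ.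
  rewrite [leRHS]ger0_norm ?addr_ge0 ?sqr_ge0//.
  rewrite ler_norml.
  move: (complex.Re (f x)) (complex.Im (f x)) (complex.Re (g x)) (complex.Im (g x)).
  move=> a b c d; have := sqr_ge0 (a + c); have := sqr_ge0 (b + d).
  have := sqr_ge0 (a - c); have := sqr_ge0 (b - d).
  have := sqr_ge0 a; have := sqr_ge0 b; have := sqr_ge0 c; have := sqr_ge0 d.
  by rewrite !sqrrD !sqrrN; lra.
- exact: integrableD.
Qed.

Lemma memL2D f g : memL2 Omega f -> memL2 Omega g ->
  memL2 Omega (fun x => f x + g x).
Proof.
move=> /memL2P[f1 f2 fi] /memL2P[g1 g2 gi].
have ReD x : complex.Re (f x + g x) = complex.Re (f x) + complex.Re (g x).
  by rewrite raddfD.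
have ImD x : complex.Im (f x + g x) = complex.Im (f x) + complex.Im (g x).
  by rewrite raddfD.
have m1 : measurable_fun Omega (fun x => complex.Re (f x + g x)).
  by under eq_fun do rewrite ReD; exact: measurable_funD.
have m2 : measurable_fun Omega (fun x => complex.Im (f x + g x)).
  by under eq_fun do rewrite ImD; exact: measurable_funD.
apply/memL2P; split=> //.
apply: (@le_integrable _ _ _ _ _ mOmega _
  (fun x => 2%:E * ((Normc.normc (f x) ^+ 2)%:E + (Normc.normc (g x) ^+ 2)%:E))%E).
- by apply/measurable_EFinP; exact: measurable_sqr_normc.
- move=> x _; rewrite /= lee_fin !sqr_normcE ReD ImD.
  rewrite !ger0_norm ?mulr_ge0 ?addr_ge0 ?sqr_ge0//.
  move: (complex.Re (f x)) (complex.Im (f x)) (complex.Re (g x)) (complex.Im (g x)).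
  move=> a b c d; have := sqr_ge0 (a - c); have := sqr_ge0 (b - d).
  by rewrite !sqrrD !sqrrN; lra.
- by apply: integrableZl => //; exact: integrableD.
Qed.

Lemma memL2Z c f : memL2 Omega f -> memL2 Omega (fun x => c * f x).
Proof.
move=> /memL2P[f1 f2 fi].
have ReM x : complex.Re (c * f x) =
  complex.Re c * complex.Re (f x) - complex.Im c * complex.Im (f x).
  by case: (c); case: (f x).
have ImM x : complex.Im (c * f x) =
  complex.Re c * complex.Im (f x) + complex.Im c * complex.Re (f x).
  by case: (c); case: (f x).
apply/memL2P; split=> //.
- under eq_fun do rewrite ReM.
  by apply: measurable_funB; exact: measurable_funM.
- under eq_fun do rewrite ImM.
  by apply: measurable_funD; exact: measurable_funM.
- rewrite (_ : (fun _ => _) =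
    (fun x => (Normc.normc c ^+ 2)%:E * (Normc.normc (f x) ^+ 2)%:E)%E); last first.
    by apply/funext => x; rewrite Normc.normcM exprMn.
  exact: integrableZl.
Qed.

Lemma memL2N f : memL2 Omega f -> memL2 Omega (fun x => - f x).
Proof. by move=> /(memL2Z (-1)); under eq_fun do rewrite mulN1r. Qed.

Lemma memL2B f g : memL2 Omega f -> memL2 Omega g ->
  memL2 Omega (fun x => f x - g x).
Proof. by move=> ? ?; apply: memL2D => //; exact: memL2N. Qed.

Lemma memL20 : memL2 Omega (fun=> 0).
Proof.
apply/memL2P; split => //=.
by rewrite expr0n/= addr0 sqrtr0 expr0n; exact: integrable0.
Qed.

Lemma memL2_sum (I : Type) (r : seq I) (P : pred I) (F : I -> 'rV[R]_n -> R[i]) :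
  (forall i, P i -> memL2 Omega (F i)) ->
  memL2 Omega (fun x => \sum_(i <- r | P i) F i x).
Proof.
move=> FL2; elim: r => [|i r ih].
  by under eq_fun do rewrite big_nil; exact: memL20.
under eq_fun do rewrite big_cons.
by case Pi: (P i) => //; apply: memL2D => //; exact: FL2.
Qed.

Lemma dotL2C f g : dotL2 f g = dotL2 g f.
Proof.
rewrite !dotL2E; apply: eq_Rintegral => x _.
by rewrite !Re_mulcJ mulrC (mulrC (complex.Im _)).
Qed.

Lemma dotL2Zl c f g : dotL2 (fun x => c * f x) g = dotL2 f (fun x => c^*%C * g x).
Proof.
by rewrite !dotL2E; apply: eq_Rintegral => x _; rewrite rmorphM/= conjcK -mulrA mulrCA.
Qed.

Lemma dotL2Dl f g h : memL2 Omega f -> memL2 Omega g -> memL2 Omega h ->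
  dotL2 (fun x => f x + g x) h = dotL2 f h + dotL2 g h.
Proof.
move=> fL gL hL; rewrite !dotL2E -RintegralD//; try exact: integrable_Re_mulcJ.
by apply: eq_Rintegral => x _; rewrite mulrDl raddfD.
Qed.

Lemma dotL2Dr f g h : memL2 Omega f -> memL2 Omega g -> memL2 Omega h ->
  dotL2 h (fun x => f x + g x) = dotL2 h f + dotL2 h g.
Proof. by move=> *; rewrite dotL2C dotL2Dl// !(dotL2C h). Qed.

Lemma dotL2rZl (a : R) f g : memL2 Omega f -> memL2 Omega g ->
  dotL2 (fun x => a%:C%C * f x) g = a * dotL2 f g.
Proof.
move=> fL gL; rewrite !dotL2E -RintegralZl//; last exact: integrable_Re_mulcJ.
apply: eq_Rintegral => x _; rewrite -mulrA.
by case: (_ * _^*%C)%R => y z /=; rewrite mul0r subr0.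
Qed.

Lemma dotL2rZr (a : R) f g : memL2 Omega f -> memL2 Omega g ->
  dotL2 f (fun x => a%:C%C * g x) = a * dotL2 f g.
Proof. by move=> *; rewrite dotL2C dotL2rZl// dotL2C. Qed.

Lemma dotL2Nl f g : memL2 Omega f -> memL2 Omega g ->
  dotL2 (fun x => - f x) g = - dotL2 f g.
Proof.
move=> fL gL; rewrite -mulN1r -dotL2rZl//.
apply: (congr1 (fun h => dotL2 h g)).
by apply/funext => x; rewrite rmorphN rmorph1 mulN1r.
Qed.

Lemma dotL2Bl f g h : memL2 Omega f -> memL2 Omega g -> memL2 Omega h ->
  dotL2 (fun x => f x - g x) h = dotL2 f h - dotL2 g h.
Proof. by move=> fL gL hL; rewrite dotL2Dl ?dotL2Nl//; exact: memL2N. Qed.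

Lemma dotL2Br f g h : memL2 Omega f -> memL2 Omega g -> memL2 Omega h ->
  dotL2 h (fun x => f x - g x) = dotL2 h f - dotL2 h g.
Proof. by move=> *; rewrite dotL2C dotL2Bl// !(dotL2C h). Qed.

Lemma dotL20r f : dotL2 f (fun=> 0) = 0.
Proof.
rewrite dotL2E (@eq_Rintegral _ _ _ _ _ (fun=> 0)).
  by rewrite /Rintegral integral0.
by move=> x _; rewrite Re_mulcJ /= !mulr0 addr0.
Qed.

Lemma dotL2_sumr (I : Type) (r : seq I) (P : pred I) f (F : I -> 'rV[R]_n -> R[i]) :
  memL2 Omega f -> (forall i, P i -> memL2 Omega (F i)) ->
  dotL2 f (fun x => \sum_(i <- r | P i) F i x) = \sum_(i <- r | P i) dotL2 f (F i).
Proof.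
move=> fL FL; elim: r => [|i r ih].
  by under eq_fun do rewrite big_nil; rewrite dotL20r big_nil.
under eq_fun do rewrite big_cons.
rewrite big_cons; case Pi: (P i) => //; rewrite dotL2Dr ?ih//; first exact: FL.
exact: memL2_sum.
Qed.

Lemma Im_innerL2 f g : complex.Im (innerL2 Omega f g) = dotL2 f (fun x => 'i%C * g x).
Proof.
apply: eq_Rintegral => x _.
by case: (f x) (g x) => a b [c d] /=; ring.
Qed.

Lemma dotL2Zr_innerL2 c f g : memL2 Omega f -> memL2 Omega g ->
  dotL2 f (fun x => c * g x) = complex.Re (c^*%C * innerL2 Omega f g).
Proof.
case: c => a b fL gL.
rewrite (_ : (fun x => _) = (fun x => a%:C%C * g x + b%:C%C * ('i%C * g x))); last first.
  apply/funext => x; rewrite mulrA -mulrDl; congr (_ * _).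
  by apply/eqP; rewrite eq_complex /=; apply/andP; split; apply/eqP; ring.
rewrite dotL2Dr ?dotL2rZr//; try by repeat apply: memL2Z.
rewrite -Im_innerL2; rewrite /dotL2.
by case: (innerL2 _ _ _) => y z /=; ring.
Qed.

Lemma normL2_ge0 f : 0 <= normL2 Omega f.
Proof. exact: sqrtr_ge0. Qed.

Lemma sqr_normL2 f : normL2 Omega f ^+ 2 = dotL2 f f.
Proof.
rewrite sqr_sqrtr; last by apply: Rintegral_ge0 => x _; exact: sqr_ge0.
by apply: eq_Rintegral => x _; rewrite Re_mulcJ sqr_normcE !expr2.
Qed.

(** Cauchy-Schwarz, from the nonnegativity of the squared norm of f - t g for
    all real t. *)
Lemma dotL2_le_normL2 f g : memL2 Omega f -> memL2 Omega g ->
  dotL2 f g <= normL2 Omega f * normL2 Omega g.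
Proof.
move=> fL gL.
have [|c0] := leP (dotL2 f g) 0.
  by move=> /le_trans; apply; rewrite mulr_ge0// normL2_ge0.
have quad (t : R) : 0 <= normL2 Omega f ^+ 2 - 2 * t * dotL2 f g
    + t ^+ 2 * normL2 Omega g ^+ 2.
  have tgL := memL2Z t%:C%C gL.
  rewrite (_ : _ + _ = normL2 Omega (fun x => f x - t%:C%C * g x) ^+ 2) ?sqr_ge0//.
  rewrite !sqr_normL2 dotL2Bl ?dotL2Br ?dotL2rZr ?dotL2rZl//; last exact: memL2B.
  by rewrite (dotL2C g f); ring.
move: (normL2_ge0 f) (normL2_ge0 g) c0 quad.
move: (normL2 Omega f) (normL2 Omega g) (dotL2 f g) => a b c a0 b0 c0 quad.
have [b0'|bN0] := eqVneq b 0.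
  (* g has norm 0: the quadratic is affine in t, and negative at this t *)
  have := quad ((a ^+ 2 + 1) / (2 * c)).
  rewrite b0' (_ : _ + _ = -1); last by field; rewrite gt_eqF//.
  by lra.
have bp : 0 < b by rewrite lt_neqAle eq_sym bN0.
have := quad (c / b ^+ 2).
rewrite (_ : _ + _ = ((a * b) ^+ 2 - c ^+ 2) / b ^+ 2); last by field.
rewrite pmulr_lge0 ?invr_gt0 ?exprn_gt0// subr_ge0 ler_sqr ?nnegrE//.
  exact: ltW.
exact: mulr_ge0.
Qed.

Lemma normL2N f : normL2 Omega (fun x => - f x) = normL2 Omega f.
Proof.
congr Num.sqrt; apply: eq_Rintegral => x _.
by rewrite !sqr_normcE !raddfN/= !sqrrN.
Qed.

Lemma normr_dotL2_le f g : memL2 Omega f -> memL2 Omega g ->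
  `|dotL2 f g| <= normL2 Omega f * normL2 Omega g.
Proof.
move=> fL gL; rewrite ler_norml dotL2_le_normL2// andbT.
rewrite lerNl -dotL2Nl//; apply: (le_trans (dotL2_le_normL2 (memL2N fL) gL)).
by rewrite normL2N.
Qed.

Lemma dotL2_young (e d : R) f g : 0 < e -> memL2 Omega f -> memL2 Omega g ->
  2 * (d * dotL2 f g) <= e * normL2 Omega g ^+ 2 + d ^+ 2 / e * normL2 Omega f ^+ 2.
Proof.
move=> e0 fL gL.
have H : d * dotL2 f g <= `|d| * (normL2 Omega f * normL2 Omega g).
  by apply: (le_trans (ler_norm _)); rewrite normrM ler_wpM2l// normr_dotL2_le.
rewrite -(real_normK (num_real d)).
move: H; move: (d * _) (normL2 Omega f) (normL2 Omega g) `|d| => x a b c H.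
apply: (@le_trans _ _ (2 * (c * (a * b)))); first lra.
rewrite -subr_ge0 (_ : _ - _ = (e * b - c * a) ^+ 2 / e).
  by rewrite divr_ge0 ?sqr_ge0// ltW.
by field; rewrite gt_eqF.
Qed.

Lemma ler_normL2D f g : memL2 Omega f -> memL2 Omega g ->
  normL2 Omega (fun x => f x + g x) <= normL2 Omega f + normL2 Omega g.
Proof.
move=> fL gL; rewrite -(@ler_pXn2r _ 2)// ?nnegrE ?addr_ge0 ?normL2_ge0//.
have fgL := memL2D fL gL.
rewrite sqrrD !sqr_normL2 dotL2Dl// !dotL2Dr// (dotL2C g f).
have := dotL2_le_normL2 fL gL; lra.
Qed.

Lemma ae_Rintegral_le0 (f : 'rV[R]_n -> R) : mu.-integrable Omega (EFin \o f) ->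
  {ae mu, forall x, Omega x -> f x <= 0} -> \int[mu]_(x in Omega) f x <= 0.
Proof.
move=> fi f0; rewrite /Rintegral integralE.
have -> : (\int[mu]_(x in Omega) (fun x => (f x)%:E)^\+ x = 0)%E.
  have mf : measurable_fun Omega (fun x => (f x)%:E) by have /integrableP[] := fi.
  rewrite (@ge0_ae_eq_integral _ _ _ mu Omega _ (cst 0%E))//; first exact: integral0.
    exact: measurable_funepos.
  apply: filterS f0 => x H Ox; rewrite funeposE /=.
  by apply/max_idPr; rewrite lee_fin; exact: H.
rewrite sub0e fineN oppr_le0 fine_ge0//.
by apply: integral_ge0 => x _; exact: funeneg_ge0.
Qed.

(** How an equation tested against h is integrated: the nonlinear term is
    discarded pointwise by its sign, and only L^2 terms are left in f and g. *)
Lemma ae_dotL2_le f g h : memL2 Omega f -> memL2 Omega g -> memL2 Omega h ->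
  {ae mu, forall x, Omega x -> complex.Re ((f x - g x) * (h x)^*%C) <= 0} ->
  dotL2 f h <= dotL2 g h.
Proof.
move=> fL gL hL H; rewrite -subr_le0 -dotL2Bl//.
by apply: ae_Rintegral_le0 => //; apply: integrable_Re_mulcJ => //; exact: memL2B.
Qed.

Lemma ae_dotL2_eq f g h : memL2 Omega f -> memL2 Omega g -> memL2 Omega h ->
  {ae mu, forall x, Omega x -> f x = g x} -> dotL2 f h = dotL2 g h.
Proof.
move=> fL gL hL fg; apply/eqP; rewrite eq_le; apply/andP; split.
  by apply: ae_dotL2_le => //; apply: filterS fg => x H /H ->; rewrite subrr mul0r.
by apply: ae_dotL2_le => //; apply: filterS fg => x H /H ->; rewrite subrr mul0r.
Qed.

End L2.

(** * Continuous functions on bounded sets are square-integrable *)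

Section finite_measure.
Context {R : realType}.

Definition cube (n : nat) (M : R) : set 'rV[R]_n := [set x | forall i, `|x ord0 i| <= M].

Arguments cube n M : clear implicits.

Lemma cubeS n M : cube n.+1 M = @rV_uncons R n @^-1` (`[- M, M]%classic `*` cube n M).
Proof.
apply/seteqP; split=> [x xM|x [/= x0 xM] i].
  split=> /=; first by rewrite in_itv/= -ler_norml; exact: xM.
  by move=> i; rewrite mxE; exact: xM.
case: (unliftP ord0 i) => [j|] ->; last by move: x0; rewrite in_itv/= -ler_norml.
by have := xM j; rewrite mxE.
Qed.

Lemma measurable_cube n M : measurable (cube n M).
Proof.
elim: n => [|n ih].
  rewrite (_ : cube 0 M = setT)//; by apply/seteqP; split=> // x _ [].
rewrite cubeS -[X in measurable X]setTI; apply: measurable_rV_uncons => //.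
exact: measurableX.
Qed.

Lemma lebesgue_cube_lty n M : (lebesgue_rV R n (cube n M) < +oo)%E.
Proof.
elim: n => [|n ih].
  by rewrite /= diracE ltry.
rewrite cubeS /= /cons_measure /pushforward -comp_preimage.
rewrite (_ : _ \o _ = id) ?preimage_id; last first.
  by apply/funext => p /=; rewrite rV_consK.
rewrite product_measure1E//; last exact: measurable_cube.
have itv_lty : (@lebesgue_measure R `[(- M)%R, M]%classic < +oo)%E.
  rewrite lebesgue_measure_itv/=; case: ifP => _; last exact: ltry.
  by rewrite -EFinD ltry.
by rewrite lte_mul_pinfty// ge0_fin_numE.
Qed.

Lemma continuous_measurable_rV n (D : set 'rV[R]_n) (f : 'rV[R]_n -> R) :
  measurable D -> continuous f -> measurable_fun D f.
Proof.
move=> mD cf; apply: (measurability _ (RGenOpens.measurableE R)) => _ [_ [a [b ->]] <-].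
apply: measurableI => //; apply: open_measurable_rV.
by apply: open_comp; [move=> x _; exact: cf|exact: interval_open].
Qed.

(** A cube is both compact and of finite measure, so bounded sets are handled
    through the cubes containing them. *)
Lemma bounded_sub_cube n (D : set 'rV[R]_n) : bounded_set D ->
  exists M, D `<=` cube n M.
Proof.
move=> [M [_ DM]]; exists (M + 1).
move=> v /DM DMv i; apply: le_trans (DMv (M + 1) _); last by rewrite ltrDl.
have /mapP[j Hj ->] : `|v ord0 i| \in [seq `|v x.1 x.2| | x : 'I_1 * 'I_n].
  by apply/mapP; exists (ord0, i) => //=; rewrite mem_enum.
by rewrite [leRHS]/Num.norm /= mx_normrE; apply/bigmax_geP; right => /=; exists j.
Qed.

Lemma compact_cube n M : compact (cube n M).
Proof.
rewrite (_ : cube n M = [set v : 'rV[R]_n | forall i, `[- M, M]%classic (v ord0 i)]).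
  by apply: (@rV_compact R n (fun=> `[- M, M]%classic)) => _; exact: segment_compact.
by apply/seteqP; split=> v vM i; have := vM i; rewrite /= in_itv/= -ler_norml.
Qed.

Lemma bounded_lebesgue_lty n (D : set 'rV[R]_n) : measurable D -> bounded_set D ->
  (lebesgue_rV R n D < +oo)%E.
Proof.
move=> mD /bounded_sub_cube[M DM].
apply: (le_lt_trans _ (lebesgue_cube_lty n M)).
by apply: le_measure => //; rewrite ?inE//; exact: measurable_cube.
Qed.

Lemma continuous_bounded_on n (D : set 'rV[R]_n) (f : 'rV[R]_n -> R) :
  bounded_set D -> continuous f -> exists M, forall x, D x -> `|f x| <= M.
Proof.
move=> /bounded_sub_cube[K DK] cf.
have : compact (f @` cube n K).
  by apply: continuous_compact; [exact: continuous_subspaceT|exact: compact_cube].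
move=> /compact_bounded[M [_ HM]]; exists (M + 1) => x Dx.
by apply: (HM (M + 1)); [rewrite ltrDl|exists x => //; exact: DK].
Qed.

Lemma continuous_memL2 n (D : set 'rV[R]_n) (f : 'rV[R]_n -> R[i]) :
  measurable D -> bounded_set D ->
  continuous (fun x => complex.Re (f x)) -> continuous (fun x => complex.Im (f x)) ->
  memL2 D f.
Proof.
move=> mD bD c1 c2.
have m1 := continuous_measurable_rV mD c1; have m2 := continuous_measurable_rV mD c2.
have [M1 b1] := continuous_bounded_on bD c1; have [M2 b2] := continuous_bounded_on bD c2.
apply/memL2P; split => //.
apply: (@le_integrable _ _ _ _ _ mD _ (cst (M1 ^+ 2 + M2 ^+ 2)%:E)).
- by apply/measurable_EFinP; exact: measurable_sqr_normc.
- move=> x Dx; rewrite /= lee_fin sqr_normcE !ger0_norm ?addr_ge0 ?sqr_ge0//.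
  have sq (y M : R) : `|y| <= M -> y ^+ 2 <= M ^+ 2.
    move=> yM; have M0 : 0 <= M by apply: le_trans yM.
    by rewrite -(real_normK (num_real y)) ler_sqr.
  by rewrite lerD// sq// ?b1 ?b2.
- apply/integrableP; split=> //.
  rewrite integral_cst//= lte_mul_pinfty// bounded_lebesgue_lty//.
Qed.
End finite_measure.

(** * Green's formula and the Dirichlet eigenbasis *)

Section green.
Context {R : realType} {n : nat} (Omega : set 'rV[R]_n).
Context (oOmega : open Omega) (bOmega : bounded_set Omega).
Implicit Types (f g u w : 'rV[R]_n -> R[i]).

Let mOmega : measurable Omega := open_measurable_rV oOmega.

Lemma test_function_memL2 phi : test_function Omega phi -> memL2 Omega phi.
Proof.
by move=> [re im _ _]; apply: continuous_memL2 => //; [case: (re 0%N)|case: (im 0%N)].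
Qed.

Lemma test_function_partial_memL2 i phi : test_function Omega phi ->
  memL2 Omega (partialC i phi).
Proof.
move=> [re im _ _]; apply: continuous_memL2 => //.
  by have [_ /(_ i)[_ []]] := re 1%N.
by have [_ /(_ i)[_ []]] := im 1%N.
Qed.

Lemma weak_partialP i f : memH1 Omega f ->
  is_weak_partial Omega i f (weak_partial Omega i f).
Proof. by move=> [_ /(_ i) ex]; apply: (xgetPex (fun=> 0) ex). Qed.

Lemma weak_partial_memL2 i f : memH1 Omega f -> memL2 Omega (weak_partial Omega i f).
Proof. by move=> /(@weak_partialP i)[]. Qed.

Lemma laplacian_memL2 f : memH2 Omega f -> memL2 Omega (laplacian Omega f).
Proof.
by move=> [_ H]; apply: memL2_sum => // i _; exact: weak_partial_memL2.
Qed.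

(** For a test function g this is the definition of the weak derivative.  Both
    sides are continuous in g for the H^1 norm, whence the formula on H^1_0.  The
    constant c makes the identity of real parts carry the complex one. *)
Lemma dotL2_weak_partial i f g c : memH1 Omega f -> memH10 Omega g ->
  dotL2 Omega (weak_partial Omega i f) (fun x => c * g x) =
  - dotL2 Omega f (fun x => c * weak_partial Omega i g x).
Proof.
move=> fH [gH gH0].
have [dfL dfP] := weak_partialP i fH.
have dgL := weak_partial_memL2 i gH.
have [fL _] := fH; have [gL _] := gH.
apply/eqP; rewrite -subr_eq0 opprK; set D := _ + _.
pose K := normL2 Omega (fun x => c^*%C * weak_partial Omega i f x) +
  normL2 Omega (fun x => c^*%C * f x).
have K0 : 0 <= K by rewrite addr_ge0 ?normL2_ge0.
have DK d : 0 < d -> `|D| <= K * d.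
  move=> d0; have [phi [tphi phid]] := gH0 (d ^+ 2) (exprn_gt0 2 d0).
  have phiL := test_function_memL2 tphi.
  have dphiL := test_function_partial_memL2 i tphi.
  have test0 : dotL2 Omega (weak_partial Omega i f) (fun x => c * phi x) +
      dotL2 Omega f (fun x => c * partialC i phi x) = 0.
    rewrite !dotL2Zr_innerL2// -raddfD -mulrDr dfP//.
    by rewrite addNr mulr0.
  have -> : D = dotL2 Omega (fun x => c^*%C * weak_partial Omega i f x)
                  (fun x => g x - phi x) +
                dotL2 Omega (fun x => c^*%C * f x)
                  (fun x => weak_partial Omega i g x - partialC i phi x).
    rewrite !dotL2Zl conjcK; under eq_fun do rewrite mulrBr.
    under [X in _ + dotL2 _ _ X]eq_fun do rewrite mulrBr.
    rewrite !dotL2Br//; try exact: memL2Z.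
    by rewrite addrACA -opprD test0 subr0.
  have small (X Y : R) : 0 <= X -> 0 <= Y -> X ^+ 2 + Y < d ^+ 2 -> X <= d.
    move=> X0 Y0 H; rewrite -ler_sqr ?nnegrE//; last exact: ltW.
    by apply/ltW; apply: le_lt_trans H; rewrite lerDl.
  rewrite /K mulrDl; apply: (le_trans (ler_normD _ _)); apply: lerD.
    apply: (le_trans (normr_dotL2_le _ _ _)) => //; [exact: memL2Z|exact: memL2B|].
    apply: ler_wpM2l; first exact: normL2_ge0.
    apply: small phid; first exact: normL2_ge0.
    by apply: sumr_ge0 => j _; exact: sqr_ge0.
  apply: (le_trans (normr_dotL2_le _ _ _)) => //; [exact: memL2Z|exact: memL2B|].
  apply: ler_wpM2l; first exact: normL2_ge0.
  move: phid; rewrite (bigD1 i)//= addrCA => phid.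
  apply: small phid; first exact: normL2_ge0.
  by rewrite addr_ge0 ?sqr_ge0//; apply: sumr_ge0 => j _; exact: sqr_ge0.
rewrite -normr_le0 leNgt; apply/negP => D0.
have := DK (`|D| / (K + 1)).
have K1 : 0 < K + 1 by lra.
rewrite divr_gt0// mulrA ler_pdivlMr// => /(_ erefl).
by rewrite mulrC ler_pM2r//; lra.
Qed.

Lemma dotL2_laplacianE u g : memH2 Omega u -> memL2 Omega g ->
  dotL2 Omega (laplacian Omega u) g =
  \sum_i dotL2 Omega (weak_partial Omega i (weak_partial Omega i u)) g.
Proof.
move=> [_ uH2] gL; rewrite dotL2C /laplacian dotL2_sumr//.
  by apply: eq_bigr => i _; exact: dotL2C.
by move=> i _; exact: weak_partial_memL2.
Qed.

(** Both sides equal minus the scalar product of the gradients: integrate by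
    parts once against w and once against u. *)
Lemma dotL2_laplacian u w c : memH2 Omega u -> memH10 Omega u ->
  memH2 Omega w -> memH10 Omega w ->
  dotL2 Omega (laplacian Omega u) (fun x => c * w x) =
  dotL2 Omega u (fun x => c * laplacian Omega w x).
Proof.
move=> [uH1 uH2] u0 [wH1 wH2] w0.
have [uL _] := uH1; have [wL _] := wH1.
rewrite dotL2_laplacianE//; last exact: memL2Z.
rewrite [RHS]dotL2C dotL2Zl dotL2_laplacianE//; last exact: memL2Z.
apply: eq_bigr => i _.
apply: etrans (dotL2_weak_partial i c (uH2 i) w0) _.
have e := dotL2_weak_partial i c^*%C (wH2 i) u0.
apply: etrans (esym e); apply: (congr1 -%R).
by rewrite [RHS]dotL2C dotL2Zl conjcK.
Qed.

Context (w : nat -> 'rV[R]_n -> R[i]) (lam : nat -> R).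
Context (hw : dirichlet_eigenbasis Omega w lam).

Lemma eigenbasis_memL2 k : memL2 Omega (w k).
Proof. by have [[]] := hw. Qed.

Lemma dotL2_laplacian_eigen u k c : memH2 Omega u -> memH10 Omega u ->
  dotL2 Omega (laplacian Omega u) (fun x => c * w k x) =
  - lam k * dotL2 Omega u (fun x => c * w k x).
Proof.
move=> u2 u0; have [_ /(_ k)[w2 w0 eig] _ _ _] := hw.
have [[uL _] _] := u2; have wL := eigenbasis_memL2 k.
have dwL := laplacian_memL2 w2.
rewrite dotL2_laplacian// -dotL2rZr//; last exact: memL2Z.
rewrite [LHS]dotL2C [RHS]dotL2C; apply: ae_dotL2_eq => //; try by repeat apply: memL2Z.
apply: filterS eig => x H /H e.
rewrite -[laplacian _ _ _]opprK e mulrN mulrCA rmorphN/= mulNr.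
by [].
Qed.

(** Parseval in the form needed below: the sign can be checked on the
    components of z, because the partial sums of its expansion converge to z. *)
Lemma eigenbasis_dotL2_le0 (G z : 'rV[R]_n -> R[i]) : memL2 Omega G -> memL2 Omega z ->
  (forall k, dotL2 Omega G (fun x => innerL2 Omega z (w k) * w k x) <= 0) ->
  dotL2 Omega G z <= 0.
Proof.
move=> GL zL H; have [[_ _ /(_ z zL) S0] _ _ _ _] := hw.
have cL k : memL2 Omega (fun x => innerL2 Omega z (w k) * w k x).
  by apply: memL2Z => //; exact: eigenbasis_memL2.
have le m : dotL2 Omega G z <= normL2 Omega G *
    normL2 Omega (fun x => z x - \sum_(k < m) innerL2 Omega z (w k) * w k x).
  have sL : memL2 Omega (fun x => \sum_(k < m) innerL2 Omega z (w k) * w k x).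
    by apply: memL2_sum => // k _.
  apply: le_trans (dotL2_le_normL2 _ _ _) => //; last exact: memL2B.
  rewrite dotL2Br// dotL2_sumr// lerBrDr gerDl.
  exact: sumr_le0.
have : normL2 Omega G *
    normL2 Omega (fun x => z x - \sum_(k < m) innerL2 Omega z (w k) * w k x)
  @[m --> \oo] --> normL2 Omega G * 0 by apply: cvgMr.
rewrite mulr0 => C; rewrite -(cvg_lim (@Rhausdorff R) C).
by apply: limr_ge; [apply/cvg_ex; exists 0|exact: nearW].
Qed.

Lemma memL2_controlled_generator (z Lz : 'rV[R]_n -> R[i]) (c g m : R[i]) (N : nat) :
  memL2 Omega z -> memL2 Omega Lz ->
  memL2 Omega (fun x => c * Lz x + g * z x
    - m * \sum_(k < N) innerL2 Omega z (w k) * w k x).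
Proof.
move=> zL LzL; apply: memL2B => //.
  by apply: memL2D => //; exact: memL2Z.
apply: memL2Z => //; apply: memL2_sum => // k _.
by apply: memL2Z => //; exact: eigenbasis_memL2.
Qed.

(** Every mode of z is damped at rate at least a.  Lz stands for the Laplacian
    of z, of which only the action on the eigenbasis matters; it will be a
    difference of two Laplacians. *)
Lemma dotL2_dissipation (z Lz : 'rV[R]_n -> R[i]) (l al g m a : R) (N : nat) :
  memL2 Omega z -> memL2 Omega Lz ->
  (forall k c, dotL2 Omega Lz (fun x => c * w k x) =
     - lam k * dotL2 Omega z (fun x => c * w k x)) ->
  (forall k, - l * lam k + g - (if (k < N)%N then m else 0) <= - a) ->
  dotL2 Omega (fun x => Complex l al * Lz x + g%:C%C * z x
    - m%:C%C * \sum_(k < N) innerL2 Omega z (w k) * w k x) z <= - a * dotL2 Omega z z.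
Proof.
move=> zL LzL eig bnd.
have wL := eigenbasis_memL2.
have cL k : memL2 Omega (fun x => innerL2 Omega z (w k) * w k x) by exact: memL2Z.
have sL : memL2 Omega (fun x => \sum_(k < N) innerL2 Omega z (w k) * w k x).
  by apply: memL2_sum => // k _.
have ZL c (f : 'rV[R]_n -> R[i]) : memL2 Omega f -> memL2 Omega (fun x => c * f x).
  exact: memL2Z.
have GL := memL2_controlled_generator (Complex l al) g%:C%C m%:C%C N zL LzL.
rewrite -subr_le0 -dotL2rZl// -dotL2Bl//; last exact: ZL.
apply: eigenbasis_dotL2_le0 => //; first by apply: memL2B => //; exact: ZL.
have lLzL := ZL (Complex l al) Lz LzL; have gzL := ZL g%:C%C z zL.
move=> k; set zk := innerL2 Omega z (w k).
have zkE : dotL2 Omega z (fun x => zk * w k x) = Normc.normc zk ^+ 2.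
  by rewrite dotL2Zr_innerL2// mulrC Re_mulcJ -!expr2 sqr_normcE.
have -> : dotL2 Omega (fun x => Complex l al * Lz x + g%:C%C * z x
    - m%:C%C * (\sum_(k0 < N) innerL2 Omega z (w k0) * w k0 x) - (- a)%:C%C * z x)
    (fun x => zk * w k x) =
  (- l * lam k + g - (if (k < N)%N then m else 0) - (- a)) * Normc.normc zk ^+ 2.
  rewrite (dotL2Bl mOmega GL (ZL _ _ zL) (cL k)).
  rewrite (dotL2Bl mOmega (memL2D mOmega lLzL gzL) (ZL _ _ sL) (cL k)).
  rewrite (dotL2Dl mOmega lLzL gzL (cL k)).
  rewrite (dotL2rZl mOmega g zL (cL k)) (dotL2rZl mOmega (- a) zL (cL k)).
  rewrite (dotL2rZl mOmega m sL (cL k)) zkE.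
  have -> : dotL2 Omega (fun x => Complex l al * Lz x) (fun x => zk * w k x) =
     - l * lam k * Normc.normc zk ^+ 2.
    rewrite dotL2Zl; under [X in dotL2 _ _ X]eq_fun do rewrite mulrA.
    rewrite eig dotL2Zr_innerL2// -/zk.
    by rewrite sqr_normcE; case: (zk) => y1 y2 /=; ring.
  have -> : dotL2 Omega (fun x => \sum_(k0 < N) innerL2 Omega z (w k0) * w k0 x)
      (fun x => zk * w k x) = if (k < N)%N then Normc.normc zk ^+ 2 else 0.
    have orth j : dotL2 Omega (fun x => zk * w k x)
        (fun x => innerL2 Omega z (w j) * w j x) =
        if j == k then Normc.normc zk ^+ 2 else 0.
      rewrite dotL2C dotL2Zl; under [X in dotL2 _ _ X]eq_fun do rewrite mulrA.
      have [[_ on _] _ _ _ _] := hw.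
      rewrite dotL2Zr_innerL2// on; case: eqVneq => [->|_]; last by rewrite mulr0.
      by rewrite mulr1 -/zk sqr_normcE; case: (zk) => y1 y2 /=; ring.
    rewrite dotL2C dotL2_sumr//; last exact: cL.
    under eq_bigr do rewrite orth.
    rewrite -big_mkcond/=.
    case: ifPn => kN; last first.
      by rewrite big_pred0// => j; apply/negbTE; apply: contra kN => /eqP <-.
    by rewrite (big_pred1 (Ordinal kN)).
  by case: (k < N)%N; ring.
by rewrite mulr_le0_ge0 ?sqr_ge0// subr_le0.
Qed.

End green.

(** * Accretivity of the power nonlinearity *)

Section sinh_inequality.
Context {R : realType}.

Lemma expR_sym_le (u w : R) : 0 <= u -> u <= w ->
  expR u + expR (- u) <= expR w + expR (- w).
Proof.
move=> u0 uw; rewrite -subr_ge0.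
have eNu : expR (- u) * expR u = 1 by rewrite -expRD addNr expR0.
have eNw : expR (- w) * expR w = 1 by rewrite -expRD addNr expR0.
rewrite (_ : _ - _ = (expR w - expR u) * (1 - expR (- u) * expR (- w))).
  apply: mulr_ge0; first by rewrite subr_ge0 ler_expR.
  by rewrite subr_ge0 -expRD -expR0 ler_expR; lra.
by ring: eNu eNw.
Qed.

(** Twice the hyperbolic sine; the factor 2 cancels everywhere. *)
Definition sinhD (x : R) := expR x - expR (- x).

Lemma sinhDN x : sinhD (- x) = - sinhD x.
Proof. by rewrite /sinhD opprK opprB. Qed.

Lemma sinhD_ge0 x : 0 <= x -> 0 <= sinhD x.
Proof. by move=> x0; rewrite subr_ge0 ler_expR; lra. Qed.

(** sinh x / x is nondecreasing on the positive half-line: the difference of the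
    two sides vanishes at y = 0 and its derivative has the sign of
    cosh (b y) - cosh (a y). *)
Lemma sinhD_le (a b y : R) : 0 <= b -> b <= a -> 0 <= y ->
  a * sinhD (b * y) <= b * sinhD (a * y).
Proof.
move=> b0 ba y0.
pose F (x : R) := a * sinhD (b * x) - b * sinhD (a * x).
pose F' (x : R) := a * b *
  ((expR (b * x) + expR (- (b * x))) - (expR (a * x) + expR (- (a * x)))).
have dF (x : R) : is_derive x 1 F (F' x).
  rewrite /F /F' /sinhD; apply: is_derive_eq.
  by rewrite /GRing.scale/=; ring.
have F0 : F 0 = 0 by rewrite /F /sinhD !mulr0 oppr0 subrr !mulr0 subrr.
rewrite -subr_le0 -F0; apply: (@ler0_derive1_le_cc _ F 0 y _ _ _) => //.
- move=> x; rewrite in_itv/= => /andP[/ltW x0 _].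
  rewrite derive1E derive_val; rewrite /F' mulr_ge0_le0 ?mulr_ge0//; first by lra.
  by rewrite subr_le0; apply: expR_sym_le; rewrite ?mulr_ge0// ler_wpM2r.
- by apply: derivable_within_continuous => x _; exact: (@ex_derive _ _ _ _ _ _ _ (dF x)).
- by rewrite in_itv/= lexx ?y0.
- by rewrite in_itv/= lexx ?y0.
Qed.

Lemma normr_sinhD_le (a b y : R) : `|b| <= a ->
  a * `|sinhD (b * y)| <= `|b| * `|sinhD (a * y)|.
Proof.
have normE x : `|sinhD x| = sinhD `|x|.
  have [x0|x0] := leP 0 x; first by rewrite (ger0_norm x0) ger0_norm ?sinhD_ge0.
  by rewrite (ltr0_norm x0) sinhDN ltr0_norm// -oppr_gt0 -sinhDN subr_gt0 ltr_expR; lra.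
move=> ba; have a0 : 0 <= a by apply: le_trans ba.
by rewrite !normE !normrM (ger0_norm a0); apply: sinhD_le.
Qed.

End sinh_inequality.

Section nonlinearity.
Context {R : realType}.
Implicit Types (p r s : R).

(** Dividing by (r s)^(p / 2 + 1) turns this into
    (p + 2) |sinh (p y)| <= |p| |sinh ((p + 2) y)| at y = ln (r / s) / 2, which is
    the monotonicity of sinh x / x as |p| <= p + 2. *)
Lemma powR_diff_le p r s : -1 < p -> 0 < r -> 0 < s ->
  (p + 2) * `|r `^ p - s `^ p| * (r * s) <= `|p| * `|r `^ p * r ^+ 2 - s `^ p * s ^+ 2|.
Proof.
move=> p1 r0 s0.
pose m := (ln r + ln s) / 2; pose y := (ln r - ln s) / 2.
have rE : r = expR (m + y) by rewrite -[LHS]lnK// /m /y; congr expR; field.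
have sE : s = expR (m - y) by rewrite -[LHS]lnK// /m /y; congr expR; field.
have np : `|p| <= p + 2 by rewrite ler_norml; lra.
have powE (x : R) : expR x `^ p = expR (p * x).
  by rewrite /powR gt_eqF ?expR_gt0// expRK.
have h1 : r `^ p - s `^ p = expR (p * m) * sinhD (p * y).
  rewrite rE sE !powE /sinhD [expR _ * (_ - _)]mulrBr -!expRD.
  by congr (expR _ - expR _); ring.
have h2 : r `^ p * r ^+ 2 - s `^ p * s ^+ 2 = expR ((p + 2) * m) * sinhD ((p + 2) * y).
  rewrite rE sE !powE !expr2 /sinhD [expR _ * (_ - _)]mulrBr -!expRD.
  by congr (expR _ - expR _); ring.
have h3 : r * s = expR (2 * m).
  by rewrite rE sE -expRD; congr expR; ring.
rewrite h1 h2 h3 !normrM !(gtr0_norm (expR_gt0 _)).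
rewrite (_ : _ * _ * expR (2 * m) =
  expR ((p + 2) * m) * ((p + 2) * `|sinhD (p * y)|)); last first.
  by rewrite [in RHS]mulrDl [in RHS]expRD; ring.
rewrite [leRHS]mulrCA ler_pM2l ?expR_gt0//.
exact: normr_sinhD_le.
Qed.

(** Here A = r^p, B = s^p and x + i y is the product of a number of modulus r
    with the conjugate of one of modulus s.  Cauchy-Schwarz removes the angle,
    i.e. bounds the linear form in (x, y) by its norm times r s; squaring what
    remains and subtracting 4 p^2 A B (r s)^2 from both sides gives the square of
    the hypothesis, because p^2 + 4 (p + 1) = (p + 2)^2. *)
Lemma sector_le (p A B r s x y : R) : -1 < p -> 0 <= A -> 0 <= B -> 0 <= r -> 0 <= s ->
  x ^+ 2 + y ^+ 2 = (r * s) ^+ 2 ->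
  (p + 2) * `|A - B| * (r * s) <= `|p| * `|A * r ^+ 2 - B * s ^+ 2| ->
  2 * Num.sqrt (p + 1) * `|(A - B) * y| <= `|p| * (A * r ^+ 2 + B * s ^+ 2 - (A + B) * x).
Proof.
move=> p1 A0 B0 r0 s0 xy H.
rewrite mulrBr lerBrDr.
have q0 : 0 <= p + 1 by lra.
set L := (X in X <= _).
apply: (@le_trans _ _ `|L|); first exact: ler_norm.
rewrite -ler_sqr ?nnegrE ?normr_ge0//; last first.
  by rewrite mulr_ge0// addr_ge0// mulr_ge0// sqr_ge0.
rewrite real_normK ?num_real//.
set q := Num.sqrt (p + 1) in L *.
have q2 : q ^+ 2 = p + 1 by rewrite sqr_sqrtr.
pose U := (2 * q * `|A - B|); pose V := `|p| * (A + B).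
have LE : L = U * `|y| + V * x by rewrite /L /U /V normrM; ring.
have -> : (L ^+ 2) = (U ^+ 2 + V ^+ 2) * (`|y| ^+ 2 + x ^+ 2) - (U * x - V * `|y|) ^+ 2.
  by rewrite LE; ring.
have y2 z : `|z| ^+ 2 = z ^+ 2 :> R by rewrite real_normK ?num_real.
rewrite y2 [y ^+ 2 + _]addrC xy.
apply: (@le_trans _ _ ((U ^+ 2 + V ^+ 2) * (r * s) ^+ 2)).
  by rewrite gerBl sqr_ge0.
have H2 : ((p + 2) * `|A - B| * (r * s)) ^+ 2 <= (`|p| * `|A * r ^+ 2 - B * s ^+ 2|) ^+ 2.
  rewrite ler_sqr// nnegrE ?mulr_ge0//; lra.
move: H2; rewrite /U /V !exprMn !y2 q2.
move=> H2; rewrite -subr_ge0; rewrite -subr_ge0 in H2; apply: (le_trans H2).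
by rewrite le_eqVlt; apply/orP; left; apply/eqP; ring.
Qed.

Lemma power_nonlinearity_sector p (a b : R[i]) : -1 < p ->
  let X := (power_nonlinearity p a - power_nonlinearity p b) * (a - b)^*%C in
  2 * Num.sqrt (p + 1) * `|complex.Im X| <= `|p| * complex.Re X.
Proof.
move=> p1; set X := _ * _^*%C; rewrite /=.
set r := Normc.normc a; set s := Normc.normc b.
have r0 : 0 <= r by rewrite /r; case: (a) => *; exact: sqrtr_ge0.
have s0 : 0 <= s by rewrite /s; case: (b) => *; exact: sqrtr_ge0.
pose c := a * b^*%C.
have c2 : complex.Re c ^+ 2 + complex.Im c ^+ 2 = (r * s) ^+ 2.
  rewrite -sqr_normcE /c Normc.normcM; congr ((_ * _) ^+ 2).
  by rewrite /s; case: (b) => b1 b2 /=; rewrite sqrrN.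
pose A := r `^ p; pose B := s `^ p.
have ReX : complex.Re X = A * r ^+ 2 + B * s ^+ 2 - (A + B) * complex.Re c.
  rewrite /X /c /r /s !sqr_normcE /power_nonlinearity -/r -/s -/A -/B.
  by case: (a) (b) => a1 a2 [b1 b2] /=; ring.
have ImX : complex.Im X = - ((A - B) * complex.Im c).
  rewrite /X /c /power_nonlinearity -/r -/s -/A -/B.
  by case: (a) (b) => a1 a2 [b1 b2] /=; ring.
rewrite ReX ImX normrN.
have A0 : 0 <= A by exact: powR_ge0.
have B0 : 0 <= B by exact: powR_ge0.
have [rs0|rs0] := eqVneq (r * s) 0.
  have := c2; rewrite rs0 expr0n/= => /eqP.
  rewrite paddr_eq0 ?sqr_ge0// !sqrf_eq0 => /andP[/eqP -> /eqP ->].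
  rewrite !mulr0 normr0 mulr0 subr0 mulr_ge0// addr_ge0// mulr_ge0// sqr_ge0//.
apply: sector_le => //.
move: rs0; rewrite mulf_eq0 negb_or => /andP[rN sN].
by apply: powR_diff_le => //; rewrite lt_neqAle eq_sym ?rN ?sN.
Qed.

(** The products lie in a sector around the positive real axis
    ([power_nonlinearity_sector]), narrow enough for a rotation by the argument
    of kappa + i beta to keep them in the right half-plane. *)
Lemma power_nonlinearity_accretive p kappa beta (a b : R[i]) : -1 < p ->
  `|p| / (2 * Num.sqrt (p + 1)) * `|beta| <= kappa ->
  0 <= complex.Re (Complex kappa beta *
    (power_nonlinearity p a - power_nonlinearity p b) * (a - b)^*%C).
Proof.
move=> p1 hk; rewrite -mulrA; have := power_nonlinearity_sector a b p1 => /=.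
set X := (_ * _^*%C) => sec.
have -> : complex.Re (Complex kappa beta * X) =
    kappa * complex.Re X - beta * complex.Im X.
  by case: X {sec}.
have q0 : 0 < 2 * Num.sqrt (p + 1) by rewrite mulr_gt0// sqrtr_gt0; lra.
have ReX0 : `|p| * complex.Re X >= 0 by apply: le_trans sec; rewrite mulr_ge0// ltW.
have ImX : `|complex.Im X| <= `|p| / (2 * Num.sqrt (p + 1)) * complex.Re X.
  by rewrite mulrAC ler_pdivlMr// mulrC.
(* for p = 0 the sector degenerates to the real axis and Re X = |a - b|^2 *)
have ReX_ge0 : 0 <= complex.Re X.
  have [p0|pN0] := eqVneq p 0; last by rewrite pmulr_rge0 ?normr_gt0 in ReX0.
  rewrite /X p0 /power_nonlinearity !powRr0 !mul1r Re_mulcJ.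
  by rewrite -!expr2 addr_ge0// sqr_ge0.
rewrite subr_ge0; apply: (le_trans (ler_norm _)); rewrite normrM.
apply: (@le_trans _ _ (`|beta| * (`|p| / (2 * Num.sqrt (p + 1)) * complex.Re X))).
  exact: ler_wpM2l.
by rewrite mulrA [`|beta| * _]mulrC ler_wpM2r.
Qed.
End nonlinearity.

(** * A Gronwall inequality with exponential forcing *)

Section gronwall.
Context {R : realType}.

(** The function exp (a t) E(t) - K / (a + d) exp ((a + d) t) is
    nonincreasing. *)
Lemma gronwall_forced (E E1 : R -> R) (a d K : R) :
  (forall t : R, 0 < t -> is_derive t 1 E (E1 t)) ->
  E t @[t --> 0^'+] --> E 0 ->
  (forall t : R, 0 < t -> E1 t <= - a * E t + K * expR (d * t)) ->
  a + d != 0 ->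
  forall t : R, 0 <= t ->
    E t <= expR (- a * t) * E 0 + K / (a + d) * (expR (d * t) - expR (- a * t)).
Proof.
move=> dE E0 E1le ad t; rewrite le_eqVlt => /predU1P[<-|t0].
  by rewrite !mulr0 !expR0 mul1r subrr mulr0 addr0.
pose F x := expR (a * x) * E x - K / (a + d) * expR ((a + d) * x).
pose F1 x := expR (a * x) * (E1 x + a * E x - K * expR (d * x)).
have dF (x : R) : 0 < x -> is_derive x 1 F (F1 x).
  move=> x0; have := dE x x0 => dEx; rewrite /F /F1.
  apply: is_derive_eq; rewrite /GRing.scale/= mulrDl expRD.
  by field.
have cF (x : R) : 0 < x -> {for x, continuous F}.
  by move=> x0; apply/differentiable_continuous/derivable1_diffP; have [] := dF x x0.
have F0 : F x @[x --> 0^'+] --> F 0.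
  apply: cvgB.
    apply: cvgM => //; apply: cvg_at_right_filter.
    by apply: continuous_comp; [exact: mulrl_continuous|exact: continuous_expR].
  apply: cvgMr; apply: cvg_at_right_filter.
  by apply: continuous_comp; [exact: mulrl_continuous|exact: continuous_expR].
have : F t <= F 0.
  apply: (@ler0_derive1_le_cc _ F 0 t _ _ _) => //.
  - by move=> x; rewrite in_itv/= => /andP[x0 _]; have [] := dF x x0.
  - move=> x; rewrite in_itv/= => /andP[x0 _].
    have dFx := dF x x0; rewrite derive1E derive_val /F1.
    rewrite pmulr_rle0 ?expR_gt0//.
    by have := E1le x x0; lra.
  - apply/continuous_within_itvP => //; split => //.
      by move=> x; rewrite in_itv/= => /andP[x0 _]; exact: cF.
    by apply: cvg_at_left_filter; exact: cF.
  - by rewrite in_itv/= lexx ltW.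
  - by rewrite in_itv/= lexx ltW.
  - exact: ltW.
rewrite /F !mulr0 expR0 mul1r mulr1 => Ft.
rewrite -(@ler_pM2l _ (expR (a * t))) ?expR_gt0//.
have eN : expR (a * t) * expR (- a * t) = 1.
  by rewrite mulNr expRN mulfV// gt_eqF ?expR_gt0.
rewrite mulrDr mulrA eN mul1r mulrCA mulrBr eN -expRD -mulrDl.
by rewrite mulrBr mulr1; lra.
Qed.

End gronwall.

(** * Time derivative of the squared norm *)

Section energy.
Context {R : realType} {n : nat} (Omega : set 'rV[R]_n).
Context (mOmega : measurable Omega).
Implicit Types z zt : R -> 'rV[R]_n -> R[i].

(** Differentiability in L^2, one-sided at 0; stated apart from the spatial
    regularity so that it passes directly to differences of solutions. *)
Definition evolutionL2 z zt : Prop :=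
  [/\ forall t, 0 <= t -> memL2 Omega (z t),
      forall t, 0 <= t -> memL2 Omega (zt t) &
      forall t, 0 <= t ->
        normL2 Omega (fun x => ((s - t)^-1)%:C%C * (z s x - z t x) - zt t x)
          @[s --> within [set s | 0 <= s] t^'] --> (0 : R)].

Lemma regular_evolutionL2 u ut : regular_evolution Omega u ut -> evolutionL2 u ut.
Proof.
move=> [H1 _ H3 H4 _]; split => // t t0.
by have [[[]]] := H1 t t0.
Qed.

Lemma evolutionL2B u ut v vt : evolutionL2 u ut -> evolutionL2 v vt ->
  evolutionL2 (fun t x => u t x - v t x) (fun t x => ut t x - vt t x).
Proof.
move=> [uL utL ud] [vL vtL vd]; split=> [t t0|t t0|t t0]; [by apply: memL2B; auto..|].
have C := cvgD (ud t t0) (vd t t0); rewrite addr0 in C.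
apply: squeeze_cvgr; [|exact: cvg_cst|exact: C].
near=> s; rewrite normL2_ge0/=.
have s0 : 0 <= s by near: s; exact: withinT.
pose f x := ((s - t)^-1)%:C%C * (u s x - u t x) - ut t x.
pose g x := ((s - t)^-1)%:C%C * (v s x - v t x) - vt t x.
have fL : memL2 Omega f by apply: memL2B; [|apply: memL2Z => //; apply: memL2B|]; auto.
have gL : memL2 Omega g by apply: memL2B; [|apply: memL2Z => //; apply: memL2B|]; auto.
rewrite (_ : (fun x => _) = (fun x => f x + - g x)).
  by apply: le_trans (ler_normL2D mOmega fL (memL2N mOmega gL)) _; rewrite normL2N.
by apply/funext => x; rewrite /f /g; ring.
Unshelve. all: by end_near. Qed.

Lemma sqr_normL2_increment (f q : 'rV[R]_n -> R[i]) (c : R) :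
  memL2 Omega f -> memL2 Omega q ->
  normL2 Omega (fun x => f x + c%:C%C * q x) ^+ 2 - normL2 Omega f ^+ 2 =
  c * (2 * dotL2 Omega q f + c * normL2 Omega q ^+ 2).
Proof.
move=> fL qL; have cqL := memL2Z mOmega c%:C%C qL.
have fcqL := memL2D mOmega fL cqL.
rewrite !sqr_normL2 dotL2Dl// !dotL2Dr// !dotL2rZl// !dotL2rZr//.
by rewrite (dotL2C _ f q); ring.
Qed.

(** Writing z(s) = z(t) + (s - t) q, the quotient is
    2 (q, z(t)) + (s - t) |q|^2, where q tends to z_t in L^2.  Working on the
    half-line s >= 0 covers both the derivative at t > 0 and the right-continuity
    at t = 0. *)
Lemma sqr_normL2_quotient z zt (t : R) : evolutionL2 z zt -> 0 <= t ->
  (s - t)^-1 * (normL2 Omega (z s) ^+ 2 - normL2 Omega (z t) ^+ 2)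
    @[s --> within [set s | 0 <= s] t^'] --> 2 * dotL2 Omega (zt t) (z t).
Proof.
move=> [zL ztL zd] t0.
pose B s := 2 * (normL2 Omega (z t) *
    normL2 Omega (fun x => ((s - t)^-1)%:C%C * (z s x - z t x) - zt t x))
  + `|s - t| * (normL2 Omega (fun x =>
      ((s - t)^-1)%:C%C * (z s x - z t x) - zt t x) + normL2 Omega (zt t)) ^+ 2.
have st : `|s - t| @[s --> within [set s | 0 <= s] t^'] --> (0 : R).
  rewrite -(normr0 R) -(subrr t); apply: cvg_norm; apply: cvgB; last exact: cvg_cst.
  by move=> P /nbhs_dnbhs Pt; exact: cvg_within.
have B0 : B s @[s --> within [set s | 0 <= s] t^'] --> (0 : R).
  have := zd t t0 => zdt.
  rewrite [X in _ --> X](_ : 0 = 2 * (normL2 Omega (z t) * 0)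
    + 0 * (0 + normL2 Omega (zt t)) ^+ 2); last by ring.
  apply: cvgD; first by apply: cvgMr; exact: cvgMr.
  apply: cvgM => //; under eq_fun do rewrite expr2; rewrite expr2.
  by apply: cvgM; apply: cvgD => //; exact: cvg_cst.
set L := 2 * _.
have CL : L - B s @[s --> within [set s | 0 <= s] t^'] --> L.
  by rewrite -[X in _ --> X](subr0 L); apply: cvgB => //; exact: cvg_cst.
have CU : L + B s @[s --> within [set s | 0 <= s] t^'] --> L.
  by rewrite -[X in _ --> X](addr0 L); apply: cvgD => //; exact: cvg_cst.
apply: (squeeze_cvgr _ CL CU).
near=> s.
have s0 : 0 <= s by near: s; exact: withinT.
have sNt : s - t != 0.
  rewrite subr_eq0; near: s.
  exact: (@cvg_within _ _ _ _ [set s : R | s != t] (@nbhs_dnbhs_neq R t)).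
suff : `|(s - t)^-1 * (normL2 Omega (z s) ^+ 2 - normL2 Omega (z t) ^+ 2) - L| <= B s.
  by rewrite ler_norml => /andP[]; lra.
pose q := fun x => ((s - t)^-1)%:C%C * (z s x - z t x).
have zsL := zL s s0; have ztL' := zL t t0; have zttL := ztL t t0.
have qL : memL2 Omega q by apply: memL2Z => //; exact: memL2B.
have zsE : z s = fun x => z t x + (s - t)%:C%C * q x.
  apply/funext => x; rewrite /q mulrA -rmorphM/= mulfV// mul1r; ring.
have QE : (s - t)^-1 * (normL2 Omega (z s) ^+ 2 - normL2 Omega (z t) ^+ 2)
    = 2 * dotL2 Omega q (z t) + (s - t) * normL2 Omega q ^+ 2.
  by rewrite zsE sqr_normL2_increment//; field.
have qzL : memL2 Omega (fun x => q x - zt t x) by exact: memL2B.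
have nq : normL2 Omega q <= normL2 Omega (fun x => q x - zt t x) + normL2 Omega (zt t).
  apply: le_trans (ler_normL2D mOmega qzL zttL).
  rewrite le_eqVlt; apply/orP; left; apply/eqP; congr normL2; apply/funext => x; ring.
rewrite QE /L /B -/q.
have -> : 2 * dotL2 Omega q (z t) + (s - t) * normL2 Omega q ^+ 2
    - 2 * dotL2 Omega (zt t) (z t)
  = 2 * dotL2 Omega (fun x => q x - zt t x) (z t) + (s - t) * normL2 Omega q ^+ 2.
  by rewrite dotL2Bl//; ring.
apply: (le_trans (ler_normD _ _)); apply: lerD.
  rewrite normrM ger0_norm// ler_wpM2l// mulrC; exact: normr_dotL2_le.
rewrite normrM ler_wpM2l// ger0_norm ?sqr_ge0//.
by rewrite ler_sqr ?nnegrE ?addr_ge0 ?normL2_ge0.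
Unshelve. all: by end_near. Qed.

Lemma is_derive_sqr_normL2 z zt (t : R) : evolutionL2 z zt -> 0 < t ->
  is_derive t 1 (fun s => normL2 Omega (z s) ^+ 2) (2 * dotL2 Omega (zt t) (z t)).
Proof.
move=> zev t0; have := sqr_normL2_quotient zev (ltW t0).
set E := fun s => normL2 Omega (z s) ^+ 2; set L := 2 * _ => C.
have C' : h^-1 *: (E (h *: (1 : R) + t) - E t) @[h --> 0^'] --> L.
  move=> P /C /nbhs_ballP[e /= e0 He]; apply/nbhs_ballP.
  exists (Num.min e t); first by rewrite /= lt_min e0.
  move=> h /=; rewrite /ball/= sub0r normrN lt_min => /andP[he ht] h0.
  have := He (h *: 1 + t); rewrite /ball/= /GRing.scale/= mulr1.
  rewrite (_ : t - (h + t) = - h); last by ring.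
  rewrite (_ : h + t - t = h); last by ring.
  rewrite normrN; apply => //; first by rewrite -subr_eq0 addrK.
  by move: ht; rewrite ltr_norml => /andP[]; lra.
by split; [apply/cvg_ex; exists L|exact: cvg_lim C'].
Qed.

Lemma sqr_normL2_right_continuous z zt : evolutionL2 z zt ->
  normL2 Omega (z s) ^+ 2 @[s --> 0^'+] --> normL2 Omega (z 0) ^+ 2.
Proof.
move=> zev; have := sqr_normL2_quotient zev (lexx 0).
set L := 2 * _ => C.
have C' : (s - 0)^-1 * (normL2 Omega (z s) ^+ 2 - normL2 Omega (z 0) ^+ 2)
    @[s --> 0^'+] --> L.
  move=> P /C /nbhs_ballP[e /= e0 He]; apply/nbhs_ballP; exists e => //= s se s0.
  by apply: He => //; [rewrite gt_eqF|exact: ltW].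
have C2 : normL2 Omega (z 0) ^+ 2 + s * ((s - 0)^-1 *
      (normL2 Omega (z s) ^+ 2 - normL2 Omega (z 0) ^+ 2))
    @[s --> 0^'+] --> normL2 Omega (z 0) ^+ 2.
  rewrite -[X in _ --> X]addr0 -[X in _ --> _ + X](mul0r L).
  apply: cvgD; first exact: cvg_cst.
  by apply: cvgM => //; apply: cvg_at_right_filter; exact: cvg_id.
apply: cvg_trans C2; apply: near_eq_cvg; near=> s.
have s0 : 0 < s by [].
by rewrite subr0 mulrA mulfV ?gt_eqF// mul1r addrC subrK.
Unshelve. all: by end_near. Qed.

End energy.

(** * Energy estimates *)

Lemma error_equation (C : comPzRingType) (c k g gt m ut vt Lu Lv fu fv u v S : C) :
  vt - c * Lv + k * fv - gt * v = 0 -> ut - c * Lu + k * fu - g * u = - m * S ->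
  (ut - vt) - (c * (Lu - Lv) + g * (u - v) - m * S + (g - gt) * v) =
  - (k * (fu - fv)).
Proof.
move=> ev eu; apply/eqP; rewrite -subr_eq0; apply/eqP.
transitivity ((ut - c * Lu + k * fu - g * u) - - m * S
  - (vt - c * Lv + k * fv - gt * v)); first by ring.
by rewrite eu ev subrr subr0.
Qed.

Section decay.
Context {R : realType} {n : nat} (Omega : set 'rV[R]_n).
Context (oOmega : open Omega) (bOmega : bounded_set Omega).
Context (w : nat -> 'rV[R]_n -> R[i]) (lam : nat -> R).
Context (hw : dirichlet_eigenbasis Omega w lam).
Context (lambda kappa gamma alpha beta p gammat mu : R).
Context (lambda_gt0 : 0 < lambda) (gamma_gt0 : 0 < gamma) (p_gtN1 : -1 < p).
Context (mu_ge : gamma <= mu) (N : nat) (hN : gamma / lambda < lam N).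
Context (hkappa : `|p| / (2 * Num.sqrt (p + 1)) * `|beta| <= kappa).
Context (v vt u ut : R -> 'rV[R]_n -> R[i]).
Context (hv : cgl_solution Omega lambda alpha kappa beta p gammat v vt (fun _ _ => 0)).
Context (hu : cgl_solution Omega lambda alpha kappa beta p gamma u ut
          (feedback Omega w mu N u v)).

Let mOmega : measurable Omega := open_measurable_rV oOmega.
Let lam0_gt0 : 0 < lam 0%N. Proof. by have [] := hw. Qed.
Let lam_le j k : (j <= k)%N -> lam j <= lam k.
Proof. by have [_ _ _ + _] := hw; apply. Qed.
Let lam_gt0 k : 0 < lam k. Proof. exact: lt_le_trans (lam_le (leq0n k)). Qed.

(** The energy inequality for v alone: the nonlinear term is the difference of
    the nonlinearity at v and at 0, so it has the right sign. *)
Lemma free_decay (t : R) : 0 <= t ->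
  normL2 Omega (v t) ^+ 2 <=
  normL2 Omega (v 0) ^+ 2 * expR (2 * (gammat - lambda * lam 0%N) * t).
Proof.
move=> t0; have [vreg veq] := hv; have vev := regular_evolutionL2 vreg.
have [vL vtL _] := vev; have [vH _ _ _ _] := vreg.
set E := fun s => normL2 Omega (v s) ^+ 2.
(* no forcing: the exponent of the zero term only has to avoid the resonance *)
have E1le (s : R) : 0 < s -> 2 * dotL2 Omega (vt s) (v s) <=
    - (2 * (lambda * lam 0%N - gammat)) * E s
      + 0 * expR ((1 - 2 * (lambda * lam 0%N - gammat)) * s).
  move=> s0; have [vH2 vH10] := vH s (ltW s0).
  have vsL := vL s (ltW s0); have vtsL := vtL s (ltW s0).
  have LL := laplacian_memL2 oOmega vH2.
  pose G x := Complex lambda alpha * laplacian Omega (v s) x + gammat%:C%C * v s x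
     - (0 : R)%:C%C * \sum_(k < 0) innerL2 Omega (v s) (w k) * w k x.
  have GL : memL2 Omega G.
    exact: (memL2_controlled_generator oOmega hw).
  have le1 : dotL2 Omega (vt s) (v s) <= dotL2 Omega G (v s).
    apply: ae_dotL2_le => //; apply: filterS (veq s s0) => x H /H e.
    have acc := power_nonlinearity_accretive (v s x) 0 p_gtN1 hkappa.
    rewrite (subr0 (v s x)) in acc.
    rewrite (_ : vt s x - G x = - (Complex kappa beta *
      (power_nonlinearity p (v s x) - power_nonlinearity p 0))).
      by rewrite mulNr raddfN/= oppr_le0.
    rewrite /G big_ord0 mulr0 subr0 {2}/power_nonlinearity mulr0 subr0.
    by apply/eqP; rewrite -subr_eq0 -e; apply/eqP; ring.
  have le2 : dotL2 Omega G (v s) <=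
      - (lambda * lam 0%N - gammat) * dotL2 Omega (v s) (v s).
    apply: (dotL2_dissipation oOmega hw) => //.
      by move=> k c; exact: (dotL2_laplacian_eigen oOmega bOmega hw).
    move=> k; rewrite ltn0 subr0.
    have := ler_wpM2l (ltW lambda_gt0) (lam_le (leq0n k)); lra.
  by rewrite /E sqr_normL2 mul0r addr0; lra.
have := gronwall_forced (fun s s0 => is_derive_sqr_normL2 mOmega vev s0)
  (sqr_normL2_right_continuous mOmega vev) E1le _ t0.
rewrite mul0r mul0r addr0 => /(_ _)/le_trans; apply.
  by rewrite addrC subrK oner_eq0.
rewrite mulrC (_ : - (2 * _) = 2 * (gammat - lambda * lam 0%N))//.
by ring.
Qed.

(** The fraction is a divided difference of exponentials, which is why a single
    formula serves on both sides of eps = omegat. *)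
Lemma controlled_decay (eps t : R) :
  let omega := 2 * (lambda - gamma * (lam N)^-1) * lam 0%N in
  let omegat := 2 * (gammat - gamma * (lam N)^-1 * lam 0%N) in
  0 < eps -> eps != omegat -> 0 <= t ->
  normL2 Omega (fun x => u t x - v t x) ^+ 2 <=
    expR (- (omega - eps) * t) * normL2 Omega (fun x => u 0 x - v 0 x) ^+ 2
    + `|gammat - gamma| ^+ 2 / eps * normL2 Omega (v 0) ^+ 2 / (omegat - eps)
      * (expR (2 * (gammat - lambda * lam 0%N) * t) - expR (- (omega - eps) * t)).
Proof.
move=> omega omegat eps0 epsN t0.
have [vreg veq] := hv; have vev := regular_evolutionL2 vreg.
have [ureg ueq] := hu; have uev := regular_evolutionL2 ureg.
have zev := evolutionL2B mOmega uev vev.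
have [vL vtL _] := vev; have [vH _ _ _ _] := vreg.
have [uL utL _] := uev; have [uH _ _ _ _] := ureg.
pose z s x := u s x - v s x; pose zt s x := ut s x - vt s x.
rewrite -/z -/zt in zev; have [zL ztL _] := zev.
pose a := (lambda - gamma * (lam N)^-1) * lam 0%N.
set K := _ / eps * _; pose d := 2 * (gammat - lambda * lam 0%N).
have ade : (omega - eps) + d = omegat - eps by rewrite /omega /omegat /d; ring.
have E1le (s : R) : 0 < s -> 2 * dotL2 Omega (zt s) (z s) <=
    - (omega - eps) * normL2 Omega (z s) ^+ 2 + K * expR (d * s).
  move=> s0; have [vH2 vH10] := vH s (ltW s0); have [uH2 uH10] := uH s (ltW s0).
  have vsL := vL s (ltW s0); have vtsL := vtL s (ltW s0).
  have usL := uL s (ltW s0); have utsL := utL s (ltW s0).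
  have zsL := zL s (ltW s0); have ztsL := ztL s (ltW s0).
  have LuL := laplacian_memL2 oOmega uH2; have LvL := laplacian_memL2 oOmega vH2.
  pose Lz x := laplacian Omega (u s) x - laplacian Omega (v s) x.
  have LzL : memL2 Omega Lz by exact: memL2B.
  pose G x := Complex lambda alpha * Lz x + gamma%:C%C * z s x
     - mu%:C%C * \sum_(k < N) innerL2 Omega (z s) (w k) * w k x.
  have GL : memL2 Omega G.
    exact: (memL2_controlled_generator oOmega hw).
  have gvL : memL2 Omega (fun x => (gamma - gammat)%:C%C * v s x) by exact: memL2Z.
  have le1 : dotL2 Omega (zt s) (z s) <=
      dotL2 Omega (fun x => G x + (gamma - gammat)%:C%C * v s x) (z s).
    apply: (ae_dotL2_le mOmega ztsL (memL2D mOmega GL gvL) zsL).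
    apply: filterS2 (veq s s0) (ueq s s0) => x Hv Hu Ox.
    have acc := power_nonlinearity_accretive (u s x) (v s x) p_gtN1 hkappa.
    have e := error_equation (Hv Ox) (Hu Ox).
    rewrite (_ : zt s x - _ = - (Complex kappa beta *
      (power_nonlinearity p (u s x) - power_nonlinearity p (v s x)))).
      by rewrite mulNr raddfN/= oppr_le0.
    by apply: etrans e; rewrite rmorphB.
  have le2 : dotL2 Omega G (z s) <= - a * dotL2 Omega (z s) (z s).
    apply: (dotL2_dissipation oOmega hw) => //.
      move=> k c; have wL := eigenbasis_memL2 hw k.
      have cwL := memL2Z mOmega c wL.
      have eu := dotL2_laplacian_eigen oOmega bOmega hw k c uH2 uH10.
      have ev := dotL2_laplacian_eigen oOmega bOmega hw k c vH2 vH10.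
      apply: etrans (dotL2Bl mOmega LuL LvL cwL) _; apply: esym.
      apply: etrans (congr1 ( *%R (- lam k)) (dotL2Bl mOmega usL vsL cwL)) _.
      apply: etrans (mulrBr _ _ _) _.
      have subE (x y x' y' : R) : x' = x -> y' = y -> x - y = x' - y' by move=> -> ->.
      exact: subE eu ev.
    move=> k; rewrite /a.
    have g0 : 0 < gamma / lam N by rewrite divr_gt0.
    have gl : gamma / lam N < lambda by rewrite ltr_pdivrMr// mulrC -ltr_pdivrMr.
    have l0 : lam 0%N <= lam k by exact: lam_le.
    case: ltnP => kN.
      have h1 : 0 <= gamma / lam N * lam 0%N by rewrite mulr_ge0// ltW.
      have h2 := ler_wpM2l (ltW lambda_gt0) l0.
      move: h1 h2 mu_ge; rewrite /a.
      by move: (gamma / lam N) (lam 0%N) (lam k) => g l l'; lra.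
    have h1 : gamma <= gamma / lam N * lam k.
      by rewrite -[leLHS](divfK (lt0r_neq0 (lam_gt0 N))) ler_pM2l// lam_le.
    have h2 : 0 <= (lambda - gamma / lam N) * (lam k - lam 0%N).
      by rewrite mulr_ge0// subr_ge0// ltW.
    move: h1 h2; move: (gamma / lam N) (lam 0%N) (lam k) => g l l'; lra.
  have le3 : 2 * ((gamma - gammat) * dotL2 Omega (v s) (z s)) <=
      eps * normL2 Omega (z s) ^+ 2
      + `|gammat - gamma| ^+ 2 / eps * normL2 Omega (v s) ^+ 2.
    by rewrite distrC real_normK ?num_real//; exact: dotL2_young.
  have K0 : 0 <= `|gammat - gamma| ^+ 2 / eps by rewrite divr_ge0 ?sqr_ge0// ltW.
  have le4 := ler_wpM2l K0 (free_decay (ltW s0)).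
  rewrite (dotL2Dl mOmega GL gvL zsL) (dotL2rZl mOmega _ vsL zsL) in le1.
  rewrite [leRHS]mulrA -/K in le4; rewrite -sqr_normL2 in le2.
  have -> : omega = 2 * a by rewrite /omega /a mulrA.
  by rewrite /d; move: le1 le2 le3 le4; clearbody K a; lra.
have := gronwall_forced (fun s s0 => is_derive_sqr_normL2 mOmega zev s0)
  (sqr_normL2_right_continuous mOmega zev) E1le _ t0.
by rewrite ade; apply; rewrite subr_eq0 eq_sym.
Qed.

End decay.

Lemma cvgr_expRM (R : realType) (c : R) : 0 < c ->
  expR (- c * t) @[t --> +oo] --> (0 : R).
Proof.
move=> c0 P /(@cvgr_expR R)[M [_ MP]].
exists (M / c); split; first exact: num_real.
move=> t Mt; rewrite /= mulNr; apply: MP.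
by rewrite -ltr_pdivrMl// mulrC.
Qed.

Unset Implicit Arguments.

Theorem theorem4p2 (R : realType) (n : nat) (n_gt0 : (0 < n)%N)
  (Omega : set 'rV[R]_n) (hOmega : bounded_C2_domain Omega)
  (w : nat -> 'rV[R]_n -> R[i]) (lam : nat -> R)
  (hw : dirichlet_eigenbasis Omega w lam)
  (lambda kappa gamma alpha beta p gammat mu : R)
  (lambda_gt0 : 0 < lambda) (kappa_gt0 : 0 < kappa) (gamma_gt0 : 0 < gamma)
  (p_gtN1 : -1 < p)
  (gammat_lt : gammat < lambda * lam 0%N)
  (mu_ge : gamma <= mu)
  (N : nat) (N_gt0 : (0 < N)%N) (hN : gamma / lambda < lam N)
  (hkappa : `|p| / (2 * Num.sqrt (p + 1)) * `|beta| <= kappa)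
  (v vt u ut : R -> 'rV[R]_n -> R[i])
  (hv : cgl_solution Omega lambda alpha kappa beta p gammat v vt
          (fun _ _ => 0))
  (hu : cgl_solution Omega lambda alpha kappa beta p gamma u ut
          (feedback Omega w mu N u v)) :
  let dist2 t := normL2 Omega (fun x => u t x - v t x) ^+ 2 in
  let v0sq := normL2 Omega (v 0) ^+ 2 in
  let omega := 2 * (lambda - gamma * (lam N)^-1) * lam 0%N in
  let omegat := 2 * (gammat - gamma * (lam N)^-1 * lam 0%N) in
  [/\ normL2 Omega (fun x => u t x - v t x) @[t --> +oo] --> (0 : R),
      gamma * (lam N)^-1 * lam 0%N < gammat ->
        forall eps t : R, 0 < eps -> eps < omegat -> 0 <= t ->
        dist2 t <= expR (- (omega - eps) * t) * dist2 0
          + `|gammat - gamma| ^+ 2 / eps * v0sq * (omegat - eps)^-1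
            * expR (2 * (gammat - lambda * lam 0%N) * t) &
      gammat <= gamma * (lam N)^-1 * lam 0%N ->
        forall eps t : R, 0 < eps -> eps < omega -> 0 <= t ->
        dist2 t <= expR (- (omega - eps) * t) * dist2 0
          + `|gammat - gamma| ^+ 2 / eps * v0sq * (eps - omegat)^-1
            * expR (- (omega - eps) * t)].
Proof.
move=> dist2 v0sq omega omegat; have [_ oO _ bO _] := hOmega.
have decay (eps t : R) : 0 < eps -> eps != omegat -> 0 <= t ->
    dist2 t <= expR (- (omega - eps) * t) * dist2 0
      + `|gammat - gamma| ^+ 2 / eps * v0sq / (omegat - eps)
      * (expR (2 * (gammat - lambda * lam 0%N) * t) - expR (- (omega - eps) * t)).
  exact: (controlled_decay oO bO hw lambda_gt0 gamma_gt0 p_gtN1 mu_ge hN hkappa hv hu).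
have K0 eps : 0 < eps -> 0 <= `|gammat - gamma| ^+ 2 / eps * v0sq.
  by move=> eps0; rewrite mulr_ge0 ?sqr_ge0// divr_ge0 ?sqr_ge0// ltW.
split.
- have [_ _ lam0 lam_le _] := hw.
  have lamN0 : 0 < lam N by apply: lt_le_trans lam0 (lam_le _ _ _).
  have omega0 : 0 < omega.
    rewrite /omega mulr_gt0// mulr_gt0// subr_gt0 ltr_pdivrMr//.
    by rewrite mulrC -ltr_pdivrMr.
  (* any eps strictly between 0 and omega avoiding omegat makes both
     exponentials decay *)
  have [eps [eps0 epso epsN]] : exists eps, [/\ 0 < eps, eps < omega & eps != omegat].
    have [e|e] := eqVneq (omega / 2) omegat; last by exists (omega / 2); split=> //; lra.
    by exists (omega / 3); split; [lra|lra|rewrite -e; apply/eqP; lra].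
  have c1 : 0 < omega - eps by rewrite subr_gt0.
  have c2 : 0 < 2 * (lambda * lam 0%N - gammat) by lra.
  have dist2_0 : dist2 t @[t --> +oo] --> (0 : R).
    pose bound t := expR (- (omega - eps) * t) * dist2 0
      + `|gammat - gamma| ^+ 2 / eps * v0sq / (omegat - eps)
      * (expR (2 * (gammat - lambda * lam 0%N) * t) - expR (- (omega - eps) * t)).
    apply: (@squeeze_cvgr _ _ _ _ (fun=> 0) bound); [|exact: cvg_cst|].
      near=> t; have t0 : 0 <= t by near: t; exact: nbhs_pinfty_ge.
      by rewrite sqr_ge0/=; exact: decay.
    rewrite [X in _ --> X](_ : 0 = 0 * dist2 0
      + `|gammat - gamma| ^+ 2 / eps * v0sq / (omegat - eps) * (0 - 0));
      last by ring.
    apply: cvgD; first by apply: cvgMl; exact: cvgr_expRM.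
    apply: cvgMr; apply: cvgB; last exact: cvgr_expRM.
    under eq_fun do rewrite -opprB mulrN.
    exact: cvgr_expRM.
  rewrite (_ : (fun t => _) = (fun t => Num.sqrt (dist2 t))).
    rewrite -(sqrtr0 R); apply: continuous_cvg => //.
    exact: sqrt_continuous.
  by apply/funext => t; rewrite sqrtr_sqr ger0_norm// normL2_ge0.
- move=> _ eps t eps0 epsl t0; apply: le_trans (decay eps t eps0 _ t0) _.
    by rewrite lt_eqF.
  rewrite lerD2l ler_wpM2l ?divr_ge0 ?K0//; first by rewrite subr_ge0 ltW.
  by rewrite gerBl expR_ge0.
- move=> gle eps t eps0 epsl t0.
  have o0 : omegat <= 0 by rewrite /omegat; lra.
  have eo : 0 < eps - omegat by lra.
  apply: le_trans (decay eps t eps0 _ t0) _; first by rewrite gt_eqF//; lra.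
  rewrite lerD2l -(opprB eps) invrN mulrN mulNr -mulrN opprB.
  rewrite ler_wpM2l ?divr_ge0 ?K0//; first exact: ltW.
  by rewrite gerBl expR_ge0.
Unshelve. all: by end_near. Qed.
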